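(* Let $k$ and $l$ be algebraically closed fields of characteristic zero. Let $K$ be a geometric field over $k$, of transcendence degree $\ge 2$ over $k$, and let $L$ be a geometric field over $l$, of transcendence degree $\ge 2$ over $l$. Assume that there exists an injective homomorphism of abelian groups $$\psi_1 : K^*/k^* \to L^*/l^*$$ such that (1) the image of $\psi_1$ contains one primitive element of $L^*/l^*$ and two elements whose lifts to $L^*$ are algebraically independent over $l$; (2) for each $f\in K^*\setminus k^*$ there exists a $g\in L$ such that $$\psi_1\left(\overline{k(f)}^*/k^*\cap K^*/k^*\right)\subseteq \overline{l(g)}^*/l^*\cap L^*/l^*.$$ Then there exists a field embedding $\psi: K\to L$ which induces either $\psi_1$ or $\psi_1^{-1}$ (as a map $K^*/k^*\to L^*/l^*$).
   Context: An element of an abelian group is called primitive if it cannot be written as a nontrivial multiple in this group (for a multiplicatively written group: as a nontrivial power). For an infinite field $k$, a field $K$ is called geometric over $k$ if (1) $k\subset K$, and (2) for each $f\in K^*\setminus k^*$ the set $\{f+\kappa\}_{\kappa\in k}$ has at most finitely many elements whose image in $K^*/k^*$ is nonprimitive. For $f\in K$, $\overline{k(f)}$ denotes the algebraic closure of $k(f)$ inside a fixed algebraic closure of $K$; similarly $\overline{l(g)}$ for $g\in L$. Thus $\overline{k(f)}^*/k^*\cap K^*/k^*$ is the group $(\overline{k(f)}\cap K)^*/k^*$. The notation $\psi_1^{-1}$ means the homomorphism $f\mapsto \psi_1(f)^{-1}$ (composition of $\psi_1$ with inversion in the group), not an inverse map. *)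

(* Defs.v *)
From HB Require Import structures.
From mathcomp Require Import all_boot all_order all_algebra.
From mathcomp Require Import boolp classical_sets functions cardinality.

Set Implicit Arguments.
Unset Strict Implicit.
Unset Printing Implicit Defensive.

Import GRing.Theory.

Local Open Scope classical_set_scope.
Local Open Scope ring_scope.
Local Open Scope quotient_scope.

(* An inclusion of fields k ⊂ K is given by a ring morphism i : k -> K
   (automatically injective). *)

Record nonzero (K : fieldType) := Nonzero { nz_val : K; nz_neq0 : nz_val != 0 }.

HB.instance Definition _ (K : fieldType) := [isSub for @nz_val K].
HB.instance Definition _ (K : fieldType) := [Choice of nonzero K by <:].

Section NonzeroOps.
Variable K : fieldType.
Implicit Types x y : nonzero K.

Definition nz_one : nonzero K := Nonzero (oner_neq0 K).

Lemma nz_mul_subproof x y : val x * val y != 0.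
Proof. exact: mulf_neq0 (valP x) (valP y). Qed.
Definition nz_mul x y : nonzero K := Nonzero (nz_mul_subproof x y).

Lemma nz_inv_subproof x : (val x)^-1 != 0.
Proof. by rewrite invr_eq0; exact: (valP x). Qed.
Definition nz_inv x : nonzero K := Nonzero (nz_inv_subproof x).

End NonzeroOps.

Section UnitQuotient.
Variables (k K : fieldType) (i : {rmorphism k -> K}).
Implicit Types x y z : nonzero K.

Definition scalar_equiv x y : bool :=
  `[< exists c : k, c != 0 /\ val x = i c * val y >].

Lemma scalar_equiv_refl : reflexive scalar_equiv.
Proof.
by move=> x; apply/asboolP; exists 1; rewrite oner_neq0 rmorph1 mul1r.
Qed.

Lemma scalar_equiv_sym : symmetric scalar_equiv.
Proof.
have sub x y : scalar_equiv x y -> scalar_equiv y x.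
  move=> /asboolP[c [c0 e]]; apply/asboolP; exists c^-1.
  by rewrite invr_eq0 c0 e mulrA -rmorphM mulVf// rmorph1 mul1r.
by move=> x y; apply/idP/idP; apply: sub.
Qed.

Lemma scalar_equiv_trans : transitive scalar_equiv.
Proof.
move=> y x z /asboolP[c [c0 ex]] /asboolP[d [d0 ey]].
by apply/asboolP; exists (c * d); rewrite mulf_neq0// ex ey rmorphM mulrA.
Qed.

Canonical scalar_equiv_rel :=
  EquivRel scalar_equiv scalar_equiv_refl scalar_equiv_sym scalar_equiv_trans.

(* The group K^*/k^*. *)
Definition unit_quot := {eq_quot scalar_equiv}.

HB.instance Definition _ := Choice.on unit_quot.
HB.instance Definition _ := EqQuotient.on unit_quot.

Definition uq_one : unit_quot := lift_cst unit_quot (nz_one K).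
Definition uq_mul := lift_op2 unit_quot (@nz_mul K).
Definition uq_inv := lift_op1 unit_quot (@nz_inv K).

Canonical pi_uq_one_morph := PiConst uq_one.

Lemma pi_uq_mul : {morph \pi : x y / nz_mul x y >-> uq_mul x y}.
Proof.
move=> x y; unlock uq_mul; apply/eqP; rewrite piE /scalar_equiv.
have /asboolP[c [c0 ec]] : scalar_equiv x (repr (\pi_unit_quot x)).
  by have := erefl (\pi_unit_quot x); rewrite -{2}[\pi_unit_quot x]reprK
    => /eqmodP.
have /asboolP[d [d0 ed]] : scalar_equiv y (repr (\pi_unit_quot y)).
  by have := erefl (\pi_unit_quot y); rewrite -{2}[\pi_unit_quot y]reprK
    => /eqmodP.
apply/asboolP; exists (c * d); split; first exact: mulf_neq0.
by rewrite /= ec ed rmorphM mulrACA.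
Qed.
Canonical pi_uq_mul_morph := PiMorph2 pi_uq_mul.

Lemma pi_uq_inv : {morph \pi : x / nz_inv x >-> uq_inv x}.
Proof.
move=> x; unlock uq_inv; apply/eqP; rewrite piE /scalar_equiv.
have /asboolP[c [c0 ec]] : scalar_equiv x (repr (\pi_unit_quot x)).
  by have := erefl (\pi_unit_quot x); rewrite -{2}[\pi_unit_quot x]reprK
    => /eqmodP.
apply/asboolP; exists c^-1; split; first by rewrite invr_eq0.
by rewrite /= ec invfM fmorphV.
Qed.
Canonical pi_uq_inv_morph := PiMorph1 pi_uq_inv.

Lemma uq_mulA : associative uq_mul.
Proof.
elim/quotW=> x; elim/quotW=> y; elim/quotW=> z; rewrite !piE.
by congr (\pi _); apply: val_inj; rewrite /= mulrA.
Qed.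

Lemma uq_mulC : commutative uq_mul.
Proof.
elim/quotW=> x; elim/quotW=> y; rewrite !piE.
by congr (\pi _); apply: val_inj; rewrite /= mulrC.
Qed.

Lemma uq_mul1 : left_id uq_one uq_mul.
Proof.
elim/quotW=> x; rewrite !piE.
by congr (\pi _); apply: val_inj; rewrite /= mul1r.
Qed.

Lemma uq_mulV : left_inverse uq_one uq_inv uq_mul.
Proof.
elim/quotW=> x; rewrite !piE.
by congr (\pi _); apply: val_inj; rewrite /= mulVf//; exact: (valP x).
Qed.

Lemma uq_mul1r : right_id uq_one uq_mul.
Proof. by move=> u; rewrite uq_mulC uq_mul1. Qed.

Lemma uq_mulVr : right_inverse uq_one uq_inv uq_mul.
Proof. by move=> u; rewrite uq_mulC uq_mulV. Qed.

HB.instance Definition _ := isGroup.Build unit_quot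
  uq_mulA uq_mul1 uq_mul1r uq_mulV uq_mulVr.

Lemma unit_quot_mulgC (u v : unit_quot) : (u * v = v * u)%g.
Proof. exact: uq_mulC. Qed.

(* The class in K^*/k^* of a nonzero f; the value at f = 0 is irrelevant. *)
Definition uclass (f : K) : unit_quot := \pi_unit_quot (insubd (nz_one K) f).

Lemma uclassM f g : f != 0 -> g != 0 -> uclass (f * g) = (uclass f * uclass g)%g.
Proof.
move=> f0 g0; rewrite /uclass -[RHS]pi_uq_mul.
by congr (\pi _); apply: val_inj; rewrite /= !val_insubd mulf_neq0 ?f0 ?g0.
Qed.

Lemma uclass_eq f g : f != 0 -> g != 0 ->
  uclass f = uclass g <-> exists c : k, c != 0 /\ f = i c * g.
Proof.
move=> f0 g0; split.
  by move=> /eqmodP/asboolP; rewrite !val_insubd f0 g0.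
by move=> e; apply/eqmodP/asboolP; rewrite !val_insubd f0 g0.
Qed.

(* The subfield k(f) of K. *)
Definition simple_ext (f : K) : set K :=
  [set x | exists p q : {poly k},
     (map_poly i q).[f] != 0 /\ x = (map_poly i p).[f] / (map_poly i q).[f]].

Definition alg_indep (f g : K) : Prop :=
  forall P : {poly {poly k}},
    (map_poly (map_poly i) P).[f, g] = 0 -> P = 0.

Definition trdeg_ge2 : Prop := exists f g : K, alg_indep f g.

End UnitQuotient.

(* For a subfield E of K, the elements of K algebraic over E, that is, the
   intersection with K of the algebraic closure of E in that of K. *)
Definition alg_closure_in (K : fieldType) (E : set K) : set K :=
  [set x | exists p : {poly K}, [/\ p != 0, forall j, E p`_j & root p x]].

(* The subgroup (\overline{k(f)} ∩ K)^*/k^* of K^*/k^*. *)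
Definition closure_classes (k K : fieldType) (i : {rmorphism k -> K}) (f : K) :
    set (unit_quot i) :=
  uclass i @` [set x | alg_closure_in (simple_ext i f) x /\ x != 0].

Arguments closure_classes {k K} i f.

(* Negative exponents add nothing, as y ^- n = (y^-1) ^+ n, and the identity
   1 = 1 ^+ 2 is not primitive. *)
Definition primitive (G : groupType) (x : G) : Prop :=
  ~ exists (y : G) (n : nat), (1 < n)%N /\ x = (y ^+ n)%g.

(* Intended for infinite k (for finite k the condition is void). *)
Definition geometric (k K : fieldType) (i : {rmorphism k -> K}) : Prop :=
  forall f : K, f != 0 -> ~ range i f ->
    finite_set [set x : K | (exists kappa : k, x = f + i kappa) /\
                            ~ primitive (uclass i x)].

(* Main.v *)
From HB Require Import structures.
Require Import Defs.
From mathcomp Require Import all_boot all_order all_algebra.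
From mathcomp Require Import boolp classical_sets functions cardinality.
From mathcomp Require Import ring.

Set Implicit Arguments.
Unset Strict Implicit.
Unset Printing Implicit Defensive.

Import GRing.Theory.

Local Open Scope classical_set_scope.
Local Open Scope ring_scope.

(* Let T f be a lift to L of psi1 [f], and dlog f the form D |-> D (T f) / T f on
   the space Der_l(L). In characteristic zero dlog f vanishes iff f is constant,
   and condition (2) gives dlog (f + c) = rho dlog f for constants c.
   Suppose dlog x and dlog y are linearly independent, and write dlog (x + a) =
   dlog x / A a and dlog (y + b) = dlog y / B b. For a + c b = d, the element
   p = x + c y + d is (y + b) (z + c) with z = (x + a) / (y + b), so dlog p lies on
   the line through dlog (x + a) and dlog (y + b). Thus (a, b) |-> (A a, B b) maps
   lines to lines, and the fundamental theorem of affine geometry yields a field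
   embedding phi : k -> l with A a = (t + phi a) / t and B b = (s + phi b) / s;
   moreover dlog p = (t dlog x + phi c s dlog y) / (t + phi c s + phi d).
   As this form is closed, dt = kap t dlog x and ds = kap s dlog y with kap in l;
   kap is rational because T x and t are algebraically dependent, and 1 / kap is
   an integer n because almost all t + phi a are primitive. Hence T (x + a) is
   (t + phi a) ^ n up to a constant, similarly for y and for x + y with t + s.
   The data t, n, phi are determined by the forms dlog (x + a), so n and phi are
   global, x |-> t is additive, and the primitive element forces n = 1 or -1. *)

Lemma pair_eq (T U : Type) (x y : T) (a b : U) : x = y -> a = b -> (x, a) = (y, b).
Proof. by move=> -> ->. Qed.

(** * Integers and derivatives of polynomials in characteristic zero *)

Section CharacteristicZero.
Variables (F : fieldType) (char0 : [pchar F] =i pred0).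

Lemma natr_neq0 n : (0 < n)%N -> n%:R != 0 :> F.
Proof. by rewrite lt0n ((pcharf0P F).1 char0). Qed.

Lemma natr_inj : injective (fun n : nat => n%:R : F).
Proof.
move=> m n e; wlog le_mn : m n e / (m <= n)%N.
  by move=> h; case/orP: (leq_total m n) => [/h|/h] ->.
apply/eqP; rewrite eqn_leq le_mn leqNgt -subn_gt0; apply/negP => /natr_neq0.
by rewrite natrB// e subrr eqxx.
Qed.

Lemma intr_neq0 (n : int) : n != 0 -> n%:~R != 0 :> F.
Proof.
case: n => n n0; first by rewrite -pmulrn natr_neq0 ?lt0n.
by rewrite NegzE mulrNz oppr_eq0 -pmulrn natr_neq0.
Qed.

Lemma deriv_neq0 (p : {poly F}) : (1 < size p)%N -> p^`() != 0.
Proof.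
move=> sp; have sp0 : (0 < (size p).-1)%N by rewrite -ltnS prednK// ltnW.
apply/eqP => /polyP /(_ (size p).-2); rewrite coef_deriv coef0 prednK//.
apply/eqP; rewrite -mulr_natr mulf_neq0 ?natr_neq0//.
by rewrite -lead_coefE lead_coef_eq0 -size_poly_gt0 ltnW.
Qed.

End CharacteristicZero.

(** * Derivations of L over l, and the extension of partial derivations *)

Section Derivations.
Variables (l L : fieldType) (i : {rmorphism l -> L}).

Record derivation := Derivation {
  der_fun :> L -> L;
  derD : {morph der_fun : x y / x + y};
  derM : forall x y, der_fun (x * y) = der_fun x * y + x * der_fun y;
  derC : forall c, der_fun (i c) = 0 }.

Implicit Types (D : derivation) (x y z : L).

Lemma der0 D : D 0 = 0.
Proof. by have := derC D 0; rewrite rmorph0. Qed.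

Lemma der1 D : D 1 = 0.
Proof. by have := derC D 1; rewrite rmorph1. Qed.

Lemma derN D x : D (- x) = - D x.
Proof. by apply/eqP; rewrite -subr_eq0 opprK -derD addNr der0. Qed.

Lemma derB D x y : D (x - y) = D x - D y.
Proof. by rewrite derD derN. Qed.

Lemma derCM D c x : D (i c * x) = i c * D x.
Proof. by rewrite derM derC mul0r add0r. Qed.

Lemma derV D x : x != 0 -> D x^-1 = - D x / x ^+ 2.
Proof.
move=> x0; have : D (x * x^-1) = 0 by rewrite divff// der1.
rewrite derM => /eqP; rewrite addrC addr_eq0 => /eqP e.
by apply: (mulfI x0); rewrite e; field.
Qed.

Lemma der_div D x y : y != 0 -> D (x / y) = (D x * y - x * D y) / y ^+ 2.
Proof. by move=> y0; rewrite derM derV//; field. Qed.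

Lemma der_sum D (I : Type) (r : seq I) (P : pred I) (F : I -> L) :
  D (\sum_(j <- r | P j) F j) = \sum_(j <- r | P j) D (F j).
Proof. exact: (big_morph D (derD D) (der0 D)). Qed.

Lemma derXn D x n : D (x ^+ n) = n%:R * x ^+ n.-1 * D x.
Proof.
elim: n => [|n IH]; first by rewrite expr0 der1 !mul0r.
rewrite exprS derM IH/=; case: n {IH} => [|n]; first by rewrite expr0; ring.
by rewrite /= exprS [n.+2%:R]mulrS; ring.
Qed.

Lemma der_exprz D z (n : int) : z != 0 ->
  D (z ^ n) = n%:~R * (D z / z) * z ^ n.
Proof.
move=> z0; have pos m : D (z ^+ m) = m%:R * (D z / z) * z ^+ m.
  rewrite derXn; case: m => [|m]; first by rewrite !mul0r.
  by rewrite /= exprS; field.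
case: n => n; first exact: pos.
have zn : z ^+ n.+1 != 0 by rewrite expf_neq0.
rewrite NegzE -exprnN [LHS]derV// pos mulrNz -pmulrn.
by field; rewrite zn z0.
Qed.

Definition der_lin (a : L) D (b : L) D' : derivation.
Proof.
exists (fun x => a * D x + b * D' x).
- by move=> x y; rewrite !derD; ring.
- by move=> x y; rewrite !derM; ring.
- by move=> c; rewrite !derC; ring.
Defined.

(** The Lie bracket; evaluating a logarithmic form on it is how closedness of the form enters. *)
Definition der_bracket D D' : derivation.
Proof.
exists (fun x => D (D' x) - D' (D x)).
- by move=> x y; rewrite !derD; ring.
- by move=> x y; rewrite !(derM, derD); ring.
- by move=> c; rewrite !derC !der0 subr0.
Defined.

Lemma der_horner D (p : {poly L}) x :
  D p.[x] = (\poly_(j < size p) D p`_j).[x] + p^`().[x] * D x.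
Proof.
rewrite horner_coef der_sum (@horner_coef_wide _ (size p)) ?size_poly//.
rewrite [p^`().[x]](@horner_coef_wide _ (size p)); last first.
  exact: leq_trans (size_poly _ _) (leq_pred _).
under eq_bigr do rewrite derM derXn.
rewrite big_split/=; congr (_ + _).
  by apply: eq_bigr => j _; rewrite coef_poly ltn_ord.
rewrite big_distrl/=; case sp: (size p) => [|m].
  by rewrite !big_ord0.
rewrite [LHS]big_ord_recl/= mul0r mul0r mulr0 add0r [RHS]big_ord_recr/=.
rewrite coef_deriv nth_default ?sp// mul0rn !mul0r addr0.
by apply: eq_bigr => j _; rewrite /= coef_deriv -mulr_natl /bump /= add1n; ring.
Qed.

(* Zorn's lemma is applied to the graphs of partial derivations, which are the
   subrings of L[eps] = L x L that meet L eps trivially. *)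
Record der_graph (R : set (L * L)) : Prop := DerGraph {
  dg_fun : forall a, R (0, a) -> a = 0;
  dgB : forall x a y b, R (x, a) -> R (y, b) -> R (x - y, a - b);
  dgM : forall x a y b, R (x, a) -> R (y, b) -> R (x * y, a * y + x * b);
  dgC : forall c, R (i c, 0) }.

Section Graph.
Variables (R : set (L * L)) (dR : der_graph R).

Lemma dg0 : R (0, 0). Proof. by have := dgC dR 0; rewrite rmorph0. Qed.
Lemma dg1 : R (1, 0). Proof. by have := dgC dR 1; rewrite rmorph1. Qed.

Lemma dgN x a : R (x, a) -> R (- x, - a).
Proof. by move=> /(dgB dR dg0); rewrite !sub0r. Qed.

Lemma dgD x a y b : R (x, a) -> R (y, b) -> R (x + y, a + b).
Proof. by move=> xa /dgN /(dgB dR xa); rewrite !opprK. Qed.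

Lemma dg_inj x a b : R (x, a) -> R (x, b) -> a = b.
Proof.
move=> xa /(dgB dR xa); rewrite subrr => /(dg_fun dR)/eqP.
by rewrite subr_eq0 => /eqP.
Qed.

Lemma dg_sum (I : Type) (r : seq I) (F G : I -> L) :
  (forall j, R (F j, G j)) -> R (\sum_(j <- r) F j, \sum_(j <- r) G j).
Proof.
move=> h; elim: r => [|j r IH]; first by rewrite !big_nil; exact: dg0.
by rewrite !big_cons; exact: dgD.
Qed.

(** The coefficients of q are the prescribed derivatives of those of p. *)
Definition dg_poly (p q : {poly L}) := forall j, R (p`_j, q`_j).

Lemma dg_polyB p q p' q' :
  dg_poly p q -> dg_poly p' q' -> dg_poly (p - p') (q - q').
Proof. by move=> h h' j; rewrite !coefB; exact: dgB. Qed.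

Lemma dg_polyM p q p' q' :
  dg_poly p q -> dg_poly p' q' -> dg_poly (p * p') (q * p' + p * q').
Proof.
move=> h h' j; rewrite coefD !coefM -big_split/=.
by apply: dg_sum => m; exact: dgM.
Qed.

Lemma dg_polyC x a : R (x, a) -> dg_poly x%:P a%:P.
Proof. by move=> xa [|j]; rewrite !coefC//=; exact: dg0. Qed.

Lemma dg_polyX : dg_poly 'X 0.
Proof. by move=> j; rewrite coefX coef0; case: eqP => _; [exact: dg1|exact: dg0]. Qed.

Lemma dg_polyXn n : dg_poly 'X^n 0.
Proof. by move=> j; rewrite coefXn coef0; case: eqP => _; [exact: dg1|exact: dg0]. Qed.

(** The derivative of p(x) when the coefficients of p have their derivatives listed in q and x is
    assigned the derivative b. *)
Definition dg_eval (p q : {poly L}) x b := q.[x] + p^`().[x] * b.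

Lemma dg_evalB p q p' q' x b :
  dg_eval (p - p') (q - q') x b = dg_eval p q x b - dg_eval p' q' x b.
Proof. by rewrite /dg_eval derivB !hornerE; ring. Qed.

Lemma dg_evalM p q p' q' x b :
  dg_eval (p * p') (q * p' + p * q') x b =
  dg_eval p q x b * p'.[x] + p.[x] * dg_eval p' q' x b.
Proof. by rewrite /dg_eval derivM !hornerE; ring. Qed.

Definition dg_adjoin x b : set (L * L) :=
  [set z | exists p q, dg_poly p q /\ z = (p.[x], dg_eval p q x b)].

Lemma dg_adjoin_sub x b : R `<=` dg_adjoin x b.
Proof.
move=> [y a] ya; exists y%:P, a%:P; split; first exact: dg_polyC.
by rewrite /dg_eval derivC !hornerE.
Qed.

Lemma dg_adjoin_mem x b : dg_adjoin x b (x, b).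
Proof.
exists 'X, 0; split; first exact: dg_polyX.
by rewrite /dg_eval derivX !hornerE.
Qed.

(** Sums and products of values come from sums and products of polynomials, so it remains to check
    that a polynomial vanishing at x is given derivative zero. *)
Lemma dg_adjoinP x b :
  (forall p q, dg_poly p q -> p.[x] = 0 -> dg_eval p q x b = 0) ->
  der_graph (dg_adjoin x b).
Proof.
move=> h; split.
- by move=> a [p [q [pq [/esym p0 ->]]]]; exact: h.
- move=> y a z c [p [q [pq [-> ->]]]] [p' [q' [pq' [-> ->]]]].
  exists (p - p'), (q - q'); split; first exact: dg_polyB.
  by rewrite dg_evalB hornerD hornerN.
- move=> y a z c [p [q [pq [-> ->]]]] [p' [q' [pq' [-> ->]]]].
  exists (p * p'), (q * p' + p * q'); split; first exact: dg_polyM.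
  by rewrite dg_evalM hornerM.
- by move=> c; apply: dg_adjoin_sub; exact: dgC.
Qed.

(** Only the zero polynomial over the domain of R vanishes at x, so the derivative of x can be
    prescribed freely. *)
Lemma dg_adjoin_transc x b :
  (forall p q, dg_poly p q -> p.[x] = 0 -> p = 0) -> der_graph (dg_adjoin x b).
Proof.
move=> h; apply: dg_adjoinP => p q pq /(h _ _ pq) p0.
rewrite /dg_eval p0 derivC horner0 mul0r addr0.
suff -> : q = 0 by rewrite horner0.
by apply/polyP => j; rewrite coef0; apply: (dg_fun dR); have := pq j; rewrite p0 coef0.
Qed.

(** The extension to fractions dictated by the quotient rule. *)
Definition dg_frac : set (L * L) :=
  [set z | exists u a v b, [/\ R (u, a), R (v, b), v != 0 &
     z = (u / v, (a * v - u * b) / v ^+ 2)]].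

Lemma dg_frac_sub : R `<=` dg_frac.
Proof.
move=> [u a] ua; exists u, a, 1, 0; split=> //; first exact: dg1.
  exact: oner_neq0.
by apply: pair_eq; rewrite ?expr1n ?divr1 ?mulr1 ?mulr0 ?subr0.
Qed.

Lemma dg_fracP : der_graph dg_frac.
Proof.
split.
- move=> c [u [a [v [b [ua vb v0 [/esym/eqP e ->]]]]]].
  move: e; rewrite mulf_eq0 invr_eq0 (negPf v0) orbF => /eqP u0.
  by move: ua; rewrite u0 => /(dg_fun dR) ->; rewrite !mul0r subrr mul0r.
- move=> x c y d [u [a [v [b [ua vb v0 [-> ->]]]]]].
  move=> [u' [a' [v' [b' [ua' vb' v0' [-> ->]]]]]].
  exists (u * v' - u' * v), ((a * v' + u * b') - (a' * v + u' * b)).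
  exists (v * v'), (b * v' + v * b').
  split; [|exact: dgM|exact: mulf_neq0|].
  + by apply: dgB => //; exact: dgM.
  + by apply: pair_eq; field; rewrite v0 v0'.
- move=> x c y d [u [a [v [b [ua vb v0 [-> ->]]]]]].
  move=> [u' [a' [v' [b' [ua' vb' v0' [-> ->]]]]]].
  exists (u * u'), (a * u' + u * a'), (v * v'), (b * v' + v * b').
  split; [exact: dgM|exact: dgM|exact: mulf_neq0|].
  by apply: pair_eq; field; rewrite v0 v0'.
- by move=> c; apply: dg_frac_sub; exact: dgC.
Qed.

End Graph.

Lemma dg_maximal R0 : der_graph R0 ->
  exists2 R, der_graph R & R0 `<=` R /\
    forall R', der_graph R' -> R `<=` R' -> R' `<=` R.
Proof.
move=> d0.
(* Zorn is applied to sets A that become graphs once joined to [R0]: the union of the empty chain is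
   empty, while a graph must contain the constants. *)
have [F FP chainF|A [dA maxA]] :=
    @Zorn_bigcup _ [set A : set (L * L) | der_graph (R0 `|` A)].
  have [[A FA]|F0] := pselect (F !=set0); last first.
    rewrite (_ : \bigcup_(X in F) X = set0) /= ?setU0//.
    by apply/seteqP; split=> z // [X FX _]; case: F0; exists X.
  have UE (z : L * L) : (R0 `|` \bigcup_(X in F) X) z <-> exists2 X, F X & (R0 `|` X) z.
    split=> [[R0z|[X FX Xz]]|[X FX [R0z|Xz]]].
    - by exists A => //; left.
    - by exists X => //; right.
    - by left.
    - by right; exists X.
  have U2 (z z' : L * L) : (R0 `|` \bigcup_(X in F) X) z ->
      (R0 `|` \bigcup_(X in F) X) z' ->
      exists2 X, F X & (R0 `|` X) z /\ (R0 `|` X) z'.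
    move=> /UE[X FX Xz] /UE[Y FY Yz]; have [XY|YX] := chainF _ _ FX FY.
      by exists Y => //; split=> //; apply: setUS Xz.
    by exists X => //; split=> //; apply: setUS Yz.
  split.
  - by move=> a /UE[X /FP dX]; exact: (dg_fun dX).
  - move=> x a y b xa /(U2 _ _ xa)[X FX [{}xa yb]].
    by apply/UE; exists X => //; exact: (dgB (FP _ FX)).
  - move=> x a y b xa /(U2 _ _ xa)[X FX [{}xa yb]].
    by apply/UE; exists X => //; exact: (dgM (FP _ FX)).
  - by move=> c; left; exact: dgC.
exists (R0 `|` A) => //; split=> [z|R' dR' AR' z R'z]; first by left.
apply: contrapT => nz.
have R0R' : R0 `<=` R' by apply: subset_trans AR'.
apply: (maxA R'); last by rewrite /= ((setUidPr _ _).2 R0R').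
split; first by apply: subset_trans AR'.
by move=> R'A; apply: nz; right; exact: R'A.
Qed.

Hypothesis char0 : [pchar L] =i pred0.

(* At an algebraic x the value of the derivation is forced by differentiating
   the minimal polynomial m. *)
Lemma dg_adjoin_alg R x : der_graph R ->
  (exists p q, [/\ dg_poly R p q, p != 0 & p.[x] = 0]) ->
  (forall y a, R (y, a) -> y != 0 -> exists a', R (y^-1, a')) ->
  exists b, der_graph (dg_adjoin R x b).
Proof.
move=> dR ex Rinv.
pose P n := `[< exists p q, [/\ dg_poly R p q, p != 0, p.[x] = 0 & size p = n] >].
have exP : exists n, P n.
  by case: ex => p [q [pq p0 px]]; exists (size p); apply/asboolP; exists p, q.
case: (ex_minnP exP) => n /asboolP[m [m' [mm m0 mx sm]]] minn.
have small p q : dg_poly R p q -> p.[x] = 0 -> (size p < n)%N -> p = 0.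
  move=> pq px; apply: contraTeq => p0; rewrite -leqNgt; apply: minn.
  by apply/asboolP; exists p, q.
(* The derivative of m also has coefficients in the domain and has smaller degree, so by minimality
   it could vanish at x only by being zero. *)
have dm : m^`().[x] != 0.
  apply/eqP => dmx; have /(small m^`() m'^`()) h : dg_poly R m^`() m'^`().
    move=> j; rewrite !coef_deriv -[m`_j.+1 *+ _]mulr_natr -[m'`_j.+1 *+ _]mulr_natr.
    rewrite -[m'`_j.+1 * _]addr0.
    rewrite -[X in _ + X](mulr0 m`_j.+1); apply: dgM => //.
    by rewrite -(rmorph_nat i); exact: dgC.
  have := deriv_neq0 char0 (root_size_gt1 m0 (introT eqP mx)).
  by rewrite h ?eqxx// -sm lt_size_deriv.
pose b := - m'.[x] / m^`().[x].
have mb : dg_eval m m' x b = 0 by rewrite /dg_eval /b; field.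
exists b; apply: dg_adjoinP => // p.
(* Induction by division: subtracting u X^d m lowers the size of p and, as m has value and
   derivative zero at x, alters neither for p. *)
have [N] := ubnP (size p); elim: N p => // N IH p pN q pq px.
have [pn|np] := ltnP (size p) n.
  have p0 := small _ _ pq px pn; rewrite /dg_eval p0 derivC horner0 mul0r addr0.
  suff -> : q = 0 by rewrite horner0.
  by apply/polyP => j; rewrite coef0; apply: (dg_fun dR); have := pq j; rewrite p0 coef0.
have [a' ra] : exists a', R ((lead_coef m)^-1, a').
  by apply: Rinv (mm (size m).-1) _; rewrite -lead_coefE lead_coef_eq0.
pose d := (size p - n)%N.
have := dgM dR (pq (size p).-1) ra.
rewrite -lead_coefE; set u := lead_coef p / _; set a := (X in R (u, X)) => rua.
have cX := dg_polyM dR (dg_polyC dR rua) (dg_polyXn dR d).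
rewrite mulr0 addr0 in cX.
have cXm := dg_polyM dR cX mm.
have := dg_polyB dR pq cXm.
set r := p - _; set s := q - _ => rs.
have rx : r.[x] = 0 by rewrite /r hornerD hornerN hornerM mx mulr0 px subr0.
have sr : (size r < size p)%N.
  have n0 : (0 < n)%N by rewrite -sm size_poly_gt0.
  have p0 : (0 < size p)%N by exact: leq_trans np.
  rewrite -[in ltnRHS](prednK p0) ltnS; apply/leq_sizeP => j.
  rewrite leq_eqVlt => /orP[/eqP <-|pj].
    rewrite coefB -!mulrA coefCM coefXnM ifN; last first.
      by rewrite -leqNgt /d -subn1 leq_sub.
    rewrite (_ : (size p).-1 - d = n.-1)%N; last first.
      by rewrite /d -!subn1 subnAC subKn.
    by rewrite -[in m`_n.-1]sm -!lead_coefE /u divfK ?subrr ?lead_coef_eq0.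
  rewrite coefB nth_default; last by move: pj; rewrite -ltnS prednK.
  rewrite nth_default ?subrr// (leq_trans (size_polyMleq _ _))// sm.
  rewrite mul_polyC (leq_trans (n := (d.+1 + n).-1))//.
    rewrite -!subn1 leq_sub2r// leq_add2r (leq_trans (size_scale_leq _ _))//.
    by rewrite size_polyXn.
  by rewrite addSn /= /d subnK//; move: pj; rewrite -ltnS prednK// => /ltnW.
have := IH r (leq_trans sr _) s rs rx; rewrite -ltnS => /(_ pN).
rewrite dg_evalB dg_evalM mx mb !mulr0 addr0 subr0; exact.
Qed.

(** A maximal graph is total: passing to fractions shows that its domain is a field, and then any x,
    algebraic or transcendental over it, can be adjoined. *)
Lemma dg_extend R0 : der_graph R0 ->
  exists D : derivation, forall x a, R0 (x, a) -> D x = a.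
Proof.
move=> /dg_maximal[R dR [R0R maxR]].
have Rinv y a : R (y, a) -> y != 0 -> exists a', R (y^-1, a').
  move=> ya y0; exists ((0 * y - 1 * a) / y ^+ 2).
  apply: (maxR _ (dg_fracP dR) (dg_frac_sub dR)).
  by exists 1, 0, y, a; split=> //; [exact: dg1|rewrite div1r].
have total x : exists a, R (x, a).
  have [alg|transc] := pselect (exists p q, [/\ dg_poly R p q, p != 0 & p.[x] = 0]).
    have [b db] := dg_adjoin_alg dR alg Rinv; exists b.
    by apply: (maxR _ db (dg_adjoin_sub dR _ _)); exact: dg_adjoin_mem.
  exists 0; apply: (maxR (dg_adjoin R x 0)); last exact: dg_adjoin_mem.
    apply: dg_adjoin_transc => // p q pq px; apply: contrapT => /eqP p0.
    by apply: transc; exists p, q.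
  exact: dg_adjoin_sub.
have [D RD] := choice total.
have Duniq x a : R (x, a) -> D x = a by exact: (dg_inj dR).
have DD : {morph D : x y / x + y} by move=> x y; apply: Duniq; exact: dgD.
have DM x y : D (x * y) = D x * y + x * D y by apply: Duniq; exact: dgM.
have DC c : D (i c) = 0 by apply: Duniq; exact: dgC.
by exists (Derivation DD DM DC) => x a /R0R; exact: Duniq.
Qed.

End Derivations.

(** * Derivations detect algebraic dependence over l *)

Section Algebraicity.
Variables (l : closedFieldType) (L : fieldType) (i : {rmorphism l -> L}).
Hypothesis char0 : [pchar l] =i pred0.

Implicit Types (D : derivation i) (x y : L).

Lemma pchar0_ext : [pchar L] =i pred0.
Proof. by move=> p; rewrite (fmorph_pchar i) char0. Qed.

(** If D kills the coefficients, then D (p(x)) = p'(x) D x; so D x = 0 unless x is also a root of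
    p', which has smaller degree. *)
Lemma der_alg_coef D (p : {poly L}) x :
  p != 0 -> (forall j, D p`_j = 0) -> p.[x] = 0 -> D x = 0.
Proof.
have [n] := ubnP (size p); elim: n p => // n IH p pn p0 Dp px.
have := der_horner D p x; rewrite px der0 (_ : \poly_(j < _) _ = 0); last first.
  by apply/polyP => j; rewrite coef_poly Dp coef0 if_same.
rewrite horner0 add0r => /esym/eqP; rewrite mulf_eq0 => /orP[/eqP dpx|/eqP//].
apply: (IH p^`()) => //.
- by rewrite -ltnS (leq_trans _ pn)// ltnS lt_size_deriv.
- exact: deriv_neq0 pchar0_ext _ (root_size_gt1 p0 (introT eqP px)).
- move=> j; rewrite coef_deriv -mulr_natr -(rmorph_nat i).
  by rewrite derM Dp derC mul0r mulr0 addr0.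
Qed.

Lemma der_map_horner D (p : {poly l}) x : D x = 0 -> D (map_poly i p).[x] = 0.
Proof.
move=> Dx; rewrite der_horner Dx mulr0 addr0 (_ : \poly_(j < _) _ = 0) ?horner0//.
by apply/polyP => j; rewrite coef_poly coef_map derC coef0 if_same.
Qed.

Lemma der_simple_ext D x y : D x = 0 -> simple_ext i x y -> D y = 0.
Proof.
move=> Dx [p [q [q0 ->]]].
by rewrite der_div// !der_map_horner// mul0r mulr0 subrr mul0r.
Qed.

Lemma der_alg_closure_in D x y :
  D x = 0 -> alg_closure_in (simple_ext i x) y -> D y = 0.
Proof.
move=> Dx [p [p0 ps /eqP py]]; apply: (der_alg_coef p0) => // j.
exact: der_simple_ext (ps j).
Qed.

Lemma algebraic_closed (p : {poly l}) x :
  p != 0 -> (map_poly i p).[x] = 0 -> range i x.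
Proof.
have [r ->] := closed_field_poly_normal p => p0 /eqP.
rewrite map_polyZ hornerZ mulf_eq0 fmorph_eq0 lead_coef_eq0.
have -> : p == 0 = false.
  by apply: contraNF p0 => /eqP ->; rewrite lead_coef0 scale0r.
rewrite rmorph_prod horner_prod prodf_seq_eq0 => /hasP[a _] /=.
by rewrite map_polyXsubC hornerXsubC subr_eq0 => /eqP ->; exists a.
Qed.

Definition const_graph : set (L * L) := [set z | range i z.1 /\ z.2 = 0].

Lemma const_graphP : der_graph i const_graph.
Proof.
split.
- by move=> a [].
- move=> x u y v [/= [a _ <-] ->] [/= [b _ <-] ->]; rewrite subr0; split=> //=.
  by exists (a - b); rewrite ?rmorphB.
- move=> x u y v [/= [a _ <-] ->] [/= [b _ <-] ->].
  rewrite mul0r mulr0 addr0; split=> //=.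
  by exists (a * b); rewrite ?rmorphM.
- by move=> c; split=> //; exists c.
Qed.

Lemma poly_range (p : {poly L}) :
  (forall j, range i p`_j) -> exists q : {poly l}, p = map_poly i q.
Proof.
move=> h; have /choice[c ci] j : exists c, i c = p`_j by have [c _ <-] := h j; exists c.
exists (\poly_(j < size p) c j).
apply/polyP => j; rewrite coef_map coef_poly; case: ltnP => [_|pj].
  exact: esym (ci j).
by rewrite raddf0 nth_default.
Qed.

(** A non-constant x is transcendental over the algebraically closed l, so D x = 1 may be prescribed
    on l[x] and extended to L. *)
Lemma der_neq0 x : ~ range i x -> exists D, D x = 1.
Proof.
move=> nx; have tr p q : dg_poly const_graph p q -> p.[x] = 0 -> p = 0.
  move=> pq px; have [P e] : exists P, p = map_poly i P.
    by apply: poly_range => j; have [] := pq j.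
  have [P0|P0] := eqVneq P 0; first by rewrite e P0 rmorph0.
  by case: nx; apply: (algebraic_closed P0); rewrite -e.
have [D DE] := dg_extend pchar0_ext (dg_adjoin_transc const_graphP 1 tr).
by exists D; apply: DE; apply: (dg_adjoin_mem const_graphP).
Qed.

Lemma der_const x : (forall D, D x = 0) -> range i x.
Proof.
move=> h; apply: contrapT => /der_neq0[D Dx].
by have := oner_neq0 L; rewrite -Dx h eqxx.
Qed.

(** The zero derivation on l[y]. *)
Definition const_poly_graph (y : L) : set (L * L) :=
  [set z | (exists p : {poly l}, z.1 = (map_poly i p).[y]) /\ z.2 = 0].

Lemma const_poly_graphP y : der_graph i (const_poly_graph y).
Proof.
split.
- by move=> a [].
- move=> x u z v [/= [a ->] ->] [/= [b ->] ->]; rewrite subr0; split=> //=.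
  by exists (a - b); rewrite rmorphB hornerD hornerN.
- move=> x u z v [/= [a ->] ->] [/= [b ->] ->].
  rewrite mul0r mulr0 addr0; split=> //=.
  by exists (a * b); rewrite rmorphM hornerM.
- by move=> c; split=> //; exists c%:P; rewrite /= map_polyC hornerC.
Qed.

Lemma horner2_sum (P : {poly {poly l}}) x y :
  (map_poly (map_poly i) P).[x, y] =
  \sum_(j < size P) (map_poly i P`_j).[y] * x ^+ j.
Proof.
rewrite [_.[x%:P]](@horner_coef_wide _ (size P)) ?size_poly// horner_sum.
by apply: eq_bigr => j _; rewrite coef_map hornerM -rmorphXn /= hornerC.
Qed.

(** The zero derivation on l[y] extends with D x = 1 because x is transcendental over l[y]. *)
Lemma alg_indep_der x y : alg_indep i x y -> exists D, D y = 0 /\ D x = 1.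
Proof.
move=> xy; have tr p q : dg_poly (const_poly_graph y) p q -> p.[x] = 0 -> p = 0.
  move=> pq px.
  have /choice[c cE] : forall j, exists r : {poly l}, p`_j = (map_poly i r).[y].
    by move=> j; have [] := pq j.
  (* A relation for x over l[y] is reassembled into a bivariate polynomial, which algebraic
     independence forces to be zero. *)
  pose P := \poly_(j < size p) c j.
  have PE j : (map_poly i P`_j).[y] = p`_j.
    rewrite coef_poly; case: ltnP => // jp.
    by rewrite rmorph0 horner0 nth_default.
  have P0 : P = 0.
    apply: xy; rewrite horner2_sum -{}[RHS]px [RHS](@horner_coef_wide _ (size p))//.
    rewrite (big_ord_widen (size p) (fun j => (map_poly i P`_j).[y] * x ^+ j));
      last exact: size_poly.
    rewrite big_mkcond; apply: eq_bigr => j _; rewrite PE; case: ltnP => // Pj.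
    by rewrite -PE nth_default// rmorph0 horner0 mul0r.
  by apply/polyP => j; rewrite -PE P0 !coef0 rmorph0 horner0.
have [D DE] := dg_extend pchar0_ext (dg_adjoin_transc (const_poly_graphP y) 1 tr).
exists D; split; last by apply: DE; apply: (dg_adjoin_mem (const_poly_graphP y)).
apply: DE; apply: (dg_adjoin_sub (const_poly_graphP y)); split=> //.
by exists 'X; rewrite map_polyX hornerX.
Qed.

Lemma alg_indep_range x y : alg_indep i x y -> ~ range i y.
Proof.
move=> xy [c _ cy]; have /xy/eqP : (map_poly (map_poly i) ('X - c%:P)%:P).[x, y] = 0.
  by rewrite map_polyC hornerC /= map_polyXsubC hornerXsubC cy subrr.
by rewrite polyC_eq0 polyXsubC_eq0.
Qed.

(** Applying [D - lam a] to a relation removes the term of a and multiplies each other coefficient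
    by [lam u - lam a], which is nonzero and killed by D; induction on s concludes. *)
Lemma eigen_independent D (I : eqType) (s : seq I) (c v lam : I -> L) :
  (forall u, D (lam u) = 0) -> (forall u, D (v u) = lam u * v u) ->
  (forall u, v u != 0) -> uniq s -> {in s &, injective lam} ->
  (forall u, D (c u) = 0) -> \sum_(u <- s) c u * v u = 0 ->
  {in s, forall u, c u = 0}.
Proof.
move=> Dlam Dv v0; elim: s c => // a s IH c /= /andP[as_ us] inj Dc sum0.
have cs : {in s, forall u, c u = 0}.
  move=> u us'.
  have lin w : c w * (lam w - lam a) * v w = D (c w * v w) - lam a * (c w * v w).
    by rewrite derM Dc Dv; ring.
  have := IH (fun w => c w * (lam w - lam a)) us _ _ _ u us'.
  have sumD : \sum_(w <- s) c w * (lam w - lam a) * v w = 0.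
    have e0 : D (c a * v a) = lam a * (c a * v a) by rewrite derM Dc Dv; ring.
    under eq_bigr do rewrite lin.
    rewrite sumrB -mulr_sumr -der_sum; move/eqP: sum0.
    by rewrite big_cons addrC addr_eq0 => /eqP ->; rewrite derN e0 mulrN subrr.
  rewrite sumD => h; have /eqP : c u * (lam u - lam a) = 0.
    apply: h => // [w w' ws w's|w]; last first.
      by rewrite derM derB !Dlam Dc subrr mul0r mulr0 addr0.
    by apply: inj; rewrite inE ?ws ?w's orbT.
  rewrite mulf_eq0 subr_eq0 => /orP[/eqP//|/eqP e].
  have ua : u = a by apply: inj e; rewrite inE ?us' ?eqxx ?orbT.
  by move: as_; rewrite -ua us'.
move=> u; rewrite inE => /orP[/eqP ->|/cs//].
move: sum0; rewrite big_cons big1_seq ?addr0 => [/eqP|w /andP[_ /cs ->]].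
  by rewrite mulf_eq0 (negPf (v0 a)) orbF => /eqP.
by rewrite mul0r.
Qed.

(* If kap were irrational, the monomials t^j X^m would be eigenvectors of D
   with distinct eigenvalues, so t and X could not satisfy a polynomial
   relation. *)
Lemma eigenvalue_rational D X t kap :
  X != 0 -> t != 0 -> D X = X -> D t = kap * t -> D kap = 0 ->
  (forall D', D' X = 0 -> D' t = 0) ->
  exists m n : int, n != 0 /\ n%:~R * kap = m%:~R.
Proof.
move=> X0 t0 DX Dt Dkap dep.
have /existsNP[P /not_implyP[Ptx P0]] : ~ alg_indep i t X.
  move=> /alg_indep_der[D' [D'X D't]].
  by have := oner_neq0 L; rewrite -D't (dep _ D'X) eqxx.
(* A pair u stands for the monomial in t and X with exponents [u.1] and [u.2], an eigenvector for
   [lam u]. *)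
pose lam (u : nat * nat) := u.1%:R * kap + u.2%:R.
pose v (u : nat * nat) := t ^+ u.1 * X ^+ u.2.
pose s := [seq (j, m) | j <- iota 0 (size P), m <- iota 0 (size P`_j)].
have us : uniq s.
  apply: allpairs_uniq_dep => [|j _|]; [exact: iota_uniq|exact: iota_uniq|].
  by move=> [a b] [c d] _ _ /= [-> ->].
have Dnat n : D n%:R = 0 by rewrite -(rmorph_nat i) derC.
have Dlam u : D (lam u) = 0 by rewrite derD derM !Dnat Dkap mul0r mulr0 !addr0.
have v0 u : v u != 0 by rewrite mulf_neq0 ?expf_neq0.
have Dexp z a n : D z = a * z -> D (z ^+ n) = n%:R * a * z ^+ n.
  move=> Dz; rewrite derXn Dz; case: n => [|n]; first by rewrite !mul0r.
  by rewrite exprS /=; ring.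
have Dv u : D (v u) = lam u * v u.
  rewrite derM (Dexp _ _ _ Dt) (Dexp X 1) ?mul1r// /v /lam; ring.
have Dc u : D (i P`_(u.1)`_(u.2)) = 0 by rewrite derC.
have sum0 : \sum_(u <- s) i P`_(u.1)`_(u.2) * v u = 0.
  rewrite big_allpairs_dep/= -{}[RHS]Ptx horner2_sum.
  rewrite -(big_mkord xpredT (fun j => (map_poly i P`_j).[X] * t ^+ j)).
  rewrite /index_iota subn0.
  apply: eq_bigr => j _; rewrite (@horner_coef_wide _ (size P`_j)) ?size_poly//.
  rewrite big_distrl/= /index_iota.
  rewrite -(big_mkord xpredT (fun m => (map_poly i P`_j)`_m * X ^+ m * t ^+ j)).
  rewrite /index_iota subn0.
  by apply: eq_bigr => m _; rewrite coef_map /v /=; ring.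
have [inj|] := pselect {in s &, injective lam}.
  case: P0; apply/polyP => j; apply/polyP => m; rewrite !coef0.
  have [jP|jP] := ltnP j (size P); last by rewrite (nth_default _ jP) coef0.
  have [mP|mP] := ltnP m (size P`_j); last by rewrite nth_default.
  have : (j, m) \in s.
    by apply/allpairsPdep; exists j, m; rewrite !mem_iota !add0n.
  move=> /(eigen_independent Dlam Dv v0 us inj Dc sum0) /= /eqP.
  by rewrite fmorph_eq0 => /eqP.
(* Two distinct monomials with equal eigenvalues give the rational value of kap; if n were zero, the
   other difference of exponents would vanish too. *)
move=> /existsNP[u /existsNP[w /not_implyP[_ /not_implyP[_ /not_implyP[e uw]]]]].
exists (w.2%:Z - u.2%:Z), (u.1%:Z - w.1%:Z).
have e' : (u.1%:Z - w.1%:Z)%:~R * kap = (w.2%:Z - u.2%:Z)%:~R.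
  rewrite !rmorphB /= -!pmulrn; apply/eqP; rewrite -subr_eq0; apply/eqP.
  by rewrite -[RHS](subrr (lam w)) -{1}e /lam; ring.
split=> //; apply: contra_notN uw => /eqP n0.
have /eqP m0 : w.2%:Z - u.2%:Z == 0.
  apply: contraT => /(intr_neq0 pchar0_ext).
  by rewrite -e' n0 mul0r eqxx.
move: n0 m0 => /eqP; rewrite subr_eq0 => /eqP[n0] /eqP; rewrite subr_eq0 => /eqP[m0].
by case: (u) (w) n0 m0 => [a b] [c d] /= -> ->.
Qed.

End Algebraicity.

(* The fundamental theorem of affine geometry for a product map
   (a, b) |-> (A a, B b) which sends the non-vertical, non-horizontal lines of
   k^2 into lines missing the origin. *)
Section Collineation.
Variables (k L : fieldType) (A B : k -> L).
Hypothesis char0 : [pchar k] =i pred0.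
Hypotheses (A_inj : injective A) (B_inj : injective B) (A0 : A 0 = 1) (B0 : B 0 = 1).
Hypothesis lines : forall c d : k, c != 0 ->
  exists u v, forall a b, a + c * b = d -> u * A a + v * B b = 1.

(** The affine coordinate of A a normalized to be 0 at a = 0 and 1 at a = 1; it turns out to be a
    ring morphism. *)
Definition axis_coord (a : k) : L := (A a - 1) / (A 1 - 1).

Let A1 : A 1 - 1 != 0.
Proof. by rewrite subr_eq0 -A0 (inj_eq A_inj) oner_neq0. Qed.

Let B1 : B 1 - 1 != 0.
Proof. by rewrite subr_eq0 -B0 (inj_eq B_inj) oner_neq0. Qed.

Lemma axis_coordA a : A a = 1 + (A 1 - 1) * axis_coord a.
Proof. by rewrite /axis_coord; field. Qed.

Lemma axis_coord0 : axis_coord 0 = 0.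
Proof. by rewrite /axis_coord A0 subrr mul0r. Qed.

Lemma axis_coord1 : axis_coord 1 = 1.
Proof. by rewrite /axis_coord divff. Qed.

Lemma axis_coord_inj : injective axis_coord.
Proof. by move=> a b e; apply: A_inj; rewrite (axis_coordA a) (axis_coordA b) e. Qed.

(** The diagonal a = b goes into a line, so A and B are affinely related and share the normalized
    coordinate. *)
Lemma axis_coordB a : B a = 1 + (B 1 - 1) * axis_coord a.
Proof.
have N1 : (-1 : k) != 0 by rewrite oppr_eq0 oner_neq0.
have [u [v uv]] := lines 0 N1.
have h b : u * A b + v * B b = 1 by apply: uv; ring.
have h0 := h 0; rewrite A0 B0 !mulr1 in h0.
have u0 : u != 0.
  apply/eqP => u0; have := h 1; move: h0; rewrite u0 mul0r !add0r => ->.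
  by rewrite mul1r => /eqP; rewrite -subr_eq0 (negPf B1).
have hE b : u * (A b - 1) = - v * (B b - 1).
  apply: subr0_eq; transitivity (u * A b + v * B b - (u + v)); first by ring.
  by rewrite h h0 subrr.
have -> : axis_coord a = (B a - 1) / (B 1 - 1); last by field.
apply/eqP; rewrite /axis_coord eqr_div//; apply/eqP; apply: (mulfI u0).
by rewrite mulrA hE mulrCA hE; ring.
Qed.

(** The first relation is the equation of the line at b = 0; the second is the difference between it
    and the equation at b. *)
Lemma line_coef c d u v :
  (forall a b, a + c * b = d -> u * A a + v * B b = 1) ->
  u + v + u * (A 1 - 1) * axis_coord d = 1 /\
  forall b, u * (A 1 - 1) * (axis_coord d - axis_coord (d - c * b)) =
    v * (B 1 - 1) * axis_coord b.
Proof.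
move=> uv; have h b : u * (1 + (A 1 - 1) * axis_coord (d - c * b)) +
    v * (1 + (B 1 - 1) * axis_coord b) = 1.
  by rewrite -axis_coordA -axis_coordB; apply: uv; ring.
have h0 := h 0; rewrite axis_coord0 !mulr0 subr0 addr0 in h0.
split=> [|b]; first by rewrite -[RHS]h0; ring.
apply: subr0_eq; rewrite -[RHS](subrr (1 : L)) -[X in _ = X - _]h0.
by rewrite -[X in _ = _ - X](h b); ring.
Qed.

(** The line a - c b = d goes into a line, so [axis_coord (d + c * b)] is affine in [axis_coord b];
    taking b = 1 determines the factor. *)
Lemma axis_coord_line c d b :
  axis_coord (d + c * b) = axis_coord d + (axis_coord (d + c) - axis_coord d) * axis_coord b.
Proof.
have [->|c0] := eqVneq c 0; first by rewrite mul0r addr0 subrr mul0r addr0.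
have Nc0 : - c != 0 by rewrite oppr_eq0.
have [u [v uv]] := lines d Nc0; have [e1 e2] := line_coef uv.
have u0 : u != 0.
  apply/eqP => u0; move: e1 (e2 1); rewrite u0 !mul0r add0r addr0 => ->.
  by rewrite axis_coord1 mul1r mulr1 => /esym/eqP; rewrite (negPf B1).
have := e2 1; rewrite axis_coord1 !mulr1 => e3; have := e2 b; rewrite -e3 opprK !mulNr !opprK.
move=> e; have ue0 : u * (A 1 - 1) != 0 by exact: mulf_neq0.
have /(mulfI ue0) e' : u * (A 1 - 1) * (axis_coord d - axis_coord (d + c * b)) =
    u * (A 1 - 1) * ((axis_coord d - axis_coord (d + c)) * axis_coord b) by rewrite e; ring.
apply: subr0_eq; transitivity ((axis_coord d - axis_coord (d + c)) * axis_coord b -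
    (axis_coord d - axis_coord (d + c * b))).
  by ring.
by rewrite e' subrr.
Qed.

Lemma axis_coordM : {morph axis_coord : a b / a * b}.
Proof.
by move=> c b; have := axis_coord_line c 0 b; rewrite !add0r axis_coord0 subr0 add0r.
Qed.

(** Multiplicativity and injectivity send -1 to a square root of 1 other than 1, hence to -1.
    Testing the affine formula for 1 + b at b = -1 fixes its factor, and a + b = a (1 + b / a) gives
    the rest. *)
Lemma axis_coordD : {morph axis_coord : a b / a + b}.
Proof.
have one b : axis_coord (1 + b) = 1 + (axis_coord (1 + 1) - 1) * axis_coord b.
  by have := axis_coord_line 1 1 b; rewrite mul1r axis_coord1.
have N1 : axis_coord (-1) = -1.
  have : axis_coord (-1) * axis_coord (-1) = 1 by rewrite -axis_coordM mulrNN mulr1 axis_coord1.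
  move=> /eqP; rewrite -expr2 sqrf_eq1 => /orP[|/eqP//].
  rewrite -axis_coord1 (inj_eq axis_coord_inj) => /eqP e.
  have := natr_neq0 char0 (n := 2) isT; rewrite -[2%:R]/(1 + 1) -{1}e addNr.
  by rewrite eqxx.
have two : axis_coord (1 + 1) - 1 = 1.
  have := one (-1); rewrite subrr axis_coord0 N1 mulrN1 => /esym/eqP.
  by rewrite subr_eq0 => /eqP <-.
have {}one b : axis_coord (1 + b) = 1 + axis_coord b by rewrite one two mul1r.
move=> a b; have [->|a0] := eqVneq a 0; first by rewrite add0r axis_coord0 add0r.
have -> : a + b = a * (1 + b / a) by field.
by rewrite axis_coordM one mulrDr mulr1 -axis_coordM; congr (_ + axis_coord _); field.
Qed.

End Collineation.

(** * Powers and primitivity in the group of units modulo constants *)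

Section UnitClasses.
Variables (l L : fieldType) (i : {rmorphism l -> L}).

Lemma uclassX (f : L) n : f != 0 -> uclass i (f ^+ n) = (uclass i f ^+ n)%g.
Proof.
move=> f0; elim: n => [|n IH].
  rewrite expr0 expg0; apply: (mulgI (uclass i 1)).
  by rewrite -uclassM ?oner_neq0// !mulr1 mulg1.
by rewrite exprS expgS uclassM ?expf_neq0// IH.
Qed.

Lemma uclassCM c (f : L) : c != 0 -> f != 0 -> uclass i (i c * f) = uclass i f.
Proof.
by move=> c0 f0; apply/uclass_eq; rewrite ?mulf_neq0 ?fmorph_eq0//; exists c.
Qed.

Lemma uclassV (f : L) : f != 0 -> uclass i f^-1 = ((uclass i f)^-1)%g.
Proof.
move=> f0; apply: (mulgI (uclass i f)); rewrite mulgV -uclassM ?invr_eq0// divff//.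
by rewrite -(expr0 (1 : L)) uclassX ?oner_neq0// expg0.
Qed.

Lemma uclass_power_nonprimitive (f w : L) c (r : int) : f != 0 -> w != 0 ->
  f = i c * w ^ r -> (1 < `|r|)%N -> ~ primitive (uclass i f).
Proof.
move=> f0 w0 e r1; have c0 : c != 0.
  by move: f0; rewrite e mulf_eq0 fmorph_eq0; case: eqP.
apply; rewrite e uclassCM ?expfz_neq0//; case: r r1 {e} => n n1.
  by exists (uclass i w), n; rewrite -uclassX.
exists (uclass i w^-1), n.+1; split=> //.
by rewrite -uclassX ?invr_eq0// exprVn NegzE exprnN.
Qed.

(** If |r| > 1, infinitely many shifts t + n are nonprimitive, against geometricity; r = 0 would
    make t constant. *)
Lemma geometric_exponent (t : L) (r : int) : [pchar l] =i pred0 -> geometric i ->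
  ~ range i t ->
  (forall n : nat, exists c w, w != 0 /\ t + i n%:R = i c * w ^ r) -> `|r|%N = 1%N.
Proof.
move=> char0 geom nt pow; apply: contrapT => r1.
have tn n : t + i n%:R != 0.
  apply: contra_notN nt => /eqP e; exists (- n%:R) => //.
  by rewrite rmorphN -[RHS](addrK (i n%:R)) e sub0r.
have r2 : (1 < `|r|)%N.
  case: r r1 pow => [[|[|n]]|[|n]]// _ pow; case: nt.
  have [c [w [_ e]]] := pow 0%N; exists c => //.
  by move: e; rewrite rmorph0 addr0 expr0z mulr1.
have t0 : t != 0 by have := tn 0%N; rewrite rmorph0 addr0.
have := geom t t0 nt; set S := [set x | _] => finS.
have f_inj : injective (fun n : nat => t + i n%:R).
  by move=> m n /addrI /fmorph_inj; exact: natr_inj.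
apply: infinite_nat; have <- : (fun n : nat => t + i n%:R) @^-1` S = [set: nat].
  apply/seteqP; split=> // n _; split; first by exists n%:R.
  by have [c [w [w0 e]]] := pow n; exact: uclass_power_nonprimitive (tn n) w0 e r2.
by apply: finite_preimage finS => m n _ _; exact: f_inj.
Qed.

End UnitClasses.

(* Bezout: u n + v r = 1 exhibits z as an r-th power. *)
Lemma coprime_power (l L : fieldType) (i : {rmorphism l -> L}) (z X : L) c (n r u v : int) :
  z != 0 -> X != 0 -> u * n + v * r = 1 -> z ^ n = i c * X ^ r ->
  z = i (c ^ u) * (X ^ u * z ^ v) ^ r.
Proof.
move=> z0 X0 uv e; rewrite expfzMl mulrA exprzAC.
by rewrite fmorphXz -expfzMl -e !exprz_exp -expfzDr// [n * u]mulrC uv expr1z.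
Qed.

(** * Logarithmic differentials of lifts *)

Section LogarithmicDifferentials.
Variables (k l : closedFieldType) (K L : fieldType).
Variables (iK : {rmorphism k -> K}) (iL : {rmorphism l -> L}).
Hypotheses (char_k : [pchar k] =i pred0) (char_l : [pchar l] =i pred0).

(* T chooses lifts to L of the values of the group homomorphism. *)
Variable T : K -> L.
Hypothesis T_neq0 : forall f : K, T f != 0.
Hypothesis T_mul : forall f g : K, f != 0 -> g != 0 ->
  exists c, T (f * g) = iL c * (T f * T g).
Hypothesis T_const : forall f : K, f != 0 -> range iL (T f) <-> range iK f.
Hypothesis T_shift : forall f : K, ~ range iK f -> forall c, exists rho,
  forall D : derivation iL, D (T (f + iK c)) / T (f + iK c) = rho * (D (T f) / T f).

Hypothesis geomL : geometric iL.

Implicit Types (D : derivation iL) (f g : K).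

Definition dlog f D := D (T f) / T f.

Lemma notin_neq0 f : ~ range iK f -> f != 0.
Proof. by apply: contra_notN => /eqP ->; exists 0; rewrite ?rmorph0. Qed.

Lemma notin_shift f c : ~ range iK f -> ~ range iK (f + iK c).
Proof.
by apply: contra_not => -[a _ e]; exists (a - c); rewrite // rmorphB e addrK.
Qed.

Arguments notin_shift {f} c _ _.

Lemma derT f D : D (T f) = dlog f D * T f.
Proof. by rewrite /dlog divfK. Qed.

Lemma dlogM f g D : f != 0 -> g != 0 -> dlog (f * g) D = dlog f D + dlog g D.
Proof.
move=> f0 g0; rewrite /dlog; have [c e] := T_mul f0 g0.
have c0 : iL c != 0 by apply: contraTN (T_neq0 (f * g)) => /eqP c0; rewrite e c0 mul0r eqxx.
by rewrite e derCM derM; field; rewrite c0 !T_neq0.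
Qed.

Lemma dlogC c D : c != 0 -> dlog (iK c) D = 0.
Proof.
move=> c0; have [c' _ e] : range iL (T (iK c)).
  by apply/T_const; [rewrite fmorph_eq0|exists c].
by rewrite /dlog -e derC mul0r.
Qed.

Lemma dlogCM c f D : c != 0 -> f != 0 -> dlog (iK c * f) D = dlog f D.
Proof. by move=> c0 f0; rewrite dlogM ?fmorph_eq0// dlogC// add0r. Qed.

Lemma dlogV f D : f != 0 -> dlog f^-1 D = - dlog f D.
Proof.
move=> f0; apply/eqP; rewrite -addr_eq0 addrC -dlogM ?invr_eq0// divff//.
by rewrite -(rmorph1 iK) dlogC ?oner_neq0.
Qed.

Lemma dlog_div f g D : f != 0 -> g != 0 -> dlog (f / g) D = dlog f D - dlog g D.
Proof. by move=> f0 g0; rewrite dlogM ?invr_eq0// dlogV. Qed.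

Lemma dlog_neq0 f : ~ range iK f -> exists D, dlog f D != 0.
Proof.
move=> nf; have : ~ range iL (T f) by move=> /T_const -/(_ (notin_neq0 nf)).
move=> /(der_neq0 char_l)[D e]; exists D.
by rewrite /dlog e mul1r invr_eq0.
Qed.

Lemma dlog_lin f a D b D' : dlog f (der_lin a D b D') = a * dlog f D + b * dlog f D'.
Proof. by rewrite /dlog /=; ring. Qed.

(** The derivation [D - dlog f D * D1] kills [T f], hence z. *)
Lemma der_decomp f D1 z : dlog f D1 = 1 ->
  (forall D, D (T f) = 0 -> D z = 0) -> forall D, D z = dlog f D * D1 z.
Proof.
move=> f1 h D; have /= := h (der_lin 1 D (- dlog f D) D1).
rewrite mul1r (derT f D) derT f1 mul1r mul1r mulNr subrr mulNr.
by move=> /(_ erefl)/eqP; rewrite subr_eq0 => /eqP.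
Qed.

(** * The pencil x + a of a single function *)

Section Pencil.
Variables (x : K) (D1 : derivation iL).
Hypotheses (nx : ~ range iK x) (x1 : dlog x D1 = 1).

Definition slope (a : k) := dlog (x + iK a) D1.

Lemma dlog_shift a D : dlog (x + iK a) D = slope a * dlog x D.
Proof.
have [rho h] := T_shift nx a.
by rewrite /slope /dlog !h -/(dlog x D1) x1 mulr1.
Qed.

Lemma slope0 : slope 0 = 1.
Proof. by rewrite /slope rmorph0 addr0. Qed.

Lemma slope_neq0 a : slope a != 0.
Proof.
have [D] := dlog_neq0 (notin_shift a nx); rewrite dlog_shift.
by apply: contraNN => /eqP ->; rewrite mul0r.
Qed.

(** Equal slopes make the dlog of (x + a) / (x + b) vanish, so this quotient is a constant c; c = 1
    gives a = b, and any other c would make x constant. *)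
Lemma slope_inj : injective slope.
Proof.
move=> a b e; have xa := notin_neq0 (notin_shift a nx).
have xb := notin_neq0 (notin_shift b nx).
have [c _ ce] : range iK ((x + iK a) / (x + iK b)).
  apply: contrapT => /dlog_neq0[D]; rewrite dlog_div// !dlog_shift e subrr.
  by rewrite eqxx.
have [c1|c1] := eqVneq c 1.
  move: ce => /esym/eqP; rewrite c1 rmorph1 -(inj_eq (mulIf xb)) divfK// mul1r.
  by move=> /eqP /addrI /fmorph_inj.
case: nx; have c10 : iK (c - 1) != 0 by rewrite fmorph_eq0 subr_eq0.
exists ((a - c * b) / (c - 1)) => //; rewrite fmorph_div; apply: (mulIf c10).
rewrite divfK// !rmorphB rmorphM rmorph1.
apply: subr0_eq; transitivity (x + iK a - iK c * (x + iK b)); first by ring.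
by rewrite ce divfK// subrr.
Qed.

Lemma slope1_inv_neq1 : (slope 1)^-1 - 1 != 0.
Proof.
by rewrite subr_eq0 -(inj_eq invr_inj) invrK invr1 -slope0 (inj_eq slope_inj) oner_neq0.
Qed.

(** If D kills [T x], so does its bracket with [D1], because [D1 (T x) = T x]; hence D (D1 z) = D1
    (D z) = 0. *)
Lemma der_dep z : (forall D, D (T x) = 0 -> D z = 0) ->
  forall D, D (T x) = 0 -> D (D1 z) = 0.
Proof.
move=> zx D Dx; have := zx (der_bracket D D1); rewrite /= (zx D Dx) der0 subr0.
by apply; rewrite [D1 (T x)]derT x1 mul1r Dx der0 subrr.
Qed.

Lemma slope_dep a D : D (T x) = 0 -> D (slope a) = 0.
Proof.
move=> Dx; have dep D' : D' (T x) = 0 -> D' (T (x + iK a)) = 0.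
  by move=> D'x; rewrite derT dlog_shift /dlog D'x !(mul0r, mulr0).
rewrite /slope /dlog der_div// (dep D Dx) (der_dep dep Dx).
by rewrite mulr0 mul0r subrr mul0r.
Qed.

End Pencil.

Lemma der_inv_eq0 D z : z != 0 -> D z = 0 -> D z^-1 = 0.
Proof. by move=> z0 Dz; rewrite derV// Dz oppr0 mul0r. Qed.

(** * Two functions with independent logarithmic differentials *)

Section Pair.
Variables (x y : K) (D1 D2 : derivation iL).
Hypotheses (nx : ~ range iK x) (ny : ~ range iK y).
Hypotheses (x1 : dlog x D1 = 1) (x2 : dlog x D2 = 0).
Hypotheses (y1 : dlog y D1 = 0) (y2 : dlog y D2 = 1).

(** The differential of z is a multiple of dlog x and kills [D1], so it is zero. *)
Lemma dep_const z : (forall D, D (T x) = 0 -> D z = 0) ->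
  (forall D, D (T y) = 0 -> D z = 0) -> range iL z.
Proof.
move=> zx zy; apply: (der_const char_l) => D.
by rewrite (der_decomp x1 zx) (zy D1) ?mulr0// derT y1 mul0r.
Qed.

Definition combo (c d : k) : K := x + iK c * y + iK d.

Let A a := (slope x D1 a)^-1.
Let B b := (slope y D2 b)^-1.

(** Every point (a, b) of the line factors [combo c d] as (y + b) (z + c). With dlog (z + c) = rho
    dlog z, the coordinates of the form, multiplied by [A a] and [B b], are rho and 1 - rho, whose
    sum does not involve rho. *)
Lemma comboP c d : c != 0 -> [/\ combo c d != 0,
  (forall a b, a + c * b = d ->
     dlog (combo c d) D1 * A a + dlog (combo c d) D2 * B b = 1) &
  (forall D, dlog (combo c d) D =
     dlog (combo c d) D1 * dlog x D + dlog (combo c d) D2 * dlog y D)].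
Proof.
move=> c0; have main a b : a + c * b = d -> combo c d != 0 /\ exists rho,
    forall D, dlog (combo c d) D =
      rho * slope x D1 a * dlog x D + (1 - rho) * slope y D2 b * dlog y D.
  move=> abd; have xa := notin_neq0 (notin_shift a nx).
  have yb := notin_neq0 (notin_shift b ny).
  set z := (x + iK a) / (y + iK b).
  have dz D : dlog z D = slope x D1 a * dlog x D - slope y D2 b * dlog y D.
    by rewrite dlog_div// (dlog_shift nx x1) (dlog_shift ny y2).
  have nz : ~ range iK z.
    move=> [e _ ez]; have e0 : e != 0.
      by rewrite -(fmorph_eq0 iK) ez mulf_neq0// invr_eq0.
    have := dz D1; rewrite -ez dlogC// y1 x1 mulr0 subr0 mulr1 => /esym/eqP.
    by rewrite (negPf (slope_neq0 nx x1 a)).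
  have zc := notin_neq0 (notin_shift c nz).
  have pE : combo c d = (y + iK b) * (z + iK c).
    by rewrite /combo /z -abd rmorphD rmorphM; field.
  split; first by rewrite pE mulf_neq0.
  have [rho h] := T_shift nz c; exists rho => D.
  rewrite pE dlogM// [dlog (z + _) D]h -/(dlog z D) dz (dlog_shift ny y2); ring.
have [p0 [rho h]] := main d 0 (etrans (congr1 _ (mulr0 c)) (addr0 d)); split=> //.
- move=> a b /main[_ [{h}rho h]]; rewrite !h x1 x2 y1 y2 /A /B.
  by field; rewrite (slope_neq0 nx x1) (slope_neq0 ny y2).
- by move=> D; rewrite !h x1 x2 y1 y2; ring.
Qed.

Lemma pair_embedding : exists phi : {rmorphism k -> l},
  (forall a, A a = 1 + (A 1 - 1) * iL (phi a)) /\
  (forall b, B b = 1 + (B 1 - 1) * iL (phi b)).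
Proof.
have A_inj : injective A by move=> a b /invr_inj; exact: slope_inj.
have B_inj : injective B by move=> a b /invr_inj; exact: slope_inj.
have A0 : A 0 = 1 by rewrite /A slope0// invr1.
have B0 : B 0 = 1 by rewrite /B slope0// invr1.
have lines (c d : k) : c != 0 ->
    exists u v, forall a b, a + c * b = d -> u * A a + v * B b = 1.
  by move=> /comboP -/(_ d)[_ h _]; exists (dlog (combo c d) D1), (dlog (combo c d) D2).
(* The coordinate computed from A depends on x only, the one computed from B on y only; they agree,
   so their value is constant. *)
have coord_range a : range iL (axis_coord A a).
  have dep C D : injective C -> C 0 = 1 :> L ->
      (forall b, D (C b) = 0) -> D (axis_coord C a) = 0.
    move=> C_inj C0 DC; rewrite /axis_coord der_div ?derB ?DC ?der1.
      by rewrite subrr mul0r mulr0 subrr mul0r.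
    by rewrite subr_eq0 -C0 (inj_eq C_inj) oner_neq0.
  apply: dep_const => D Dz.
    apply: dep => // b; apply: der_inv_eq0; first exact: slope_neq0.
    exact: slope_dep.
  have -> : axis_coord A a = axis_coord B a.
    rewrite {2}/axis_coord (axis_coordB A_inj B_inj A0 B0 lines) [1 + _]addrC addrK mulrC mulKf//.
    by rewrite subr_eq0 -B0 (inj_eq B_inj) oner_neq0.
  apply: dep => // b; apply: der_inv_eq0; first exact: slope_neq0.
  exact: slope_dep.
have /choice[phi phiE] a : exists c, iL c = axis_coord A a.
  by have [c _ <-] := coord_range a; exists c.
have phi_zmod : zmod_morphism phi.
  move=> a b; apply: (fmorph_inj iL); rewrite rmorphB !phiE.
  have := axis_coordD char_k A_inj B_inj A0 B0 lines (a - b) b.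
  by rewrite subrK => ->; rewrite addrK.
have phi_monoid : monoid_morphism phi.
  split=> [|a b]; apply: (fmorph_inj iL); rewrite ?rmorph1 ?rmorphM !phiE.
    exact: axis_coord1.
  exact: (axis_coordM A_inj B_inj A0 B0 lines).
pose phiZ := GRing.isZmodMorphism.Build k l phi phi_zmod.
pose phiM := GRing.isMonoidMorphism.Build k l phi phi_monoid.
pose phiR : {rmorphism k -> l} := HB.pack phi phiZ phiM.
exists phiR; split=> a; rewrite /= phiE.
  exact: axis_coordA.
exact: (axis_coordB A_inj B_inj A0 B0 lines).
Qed.

(* The parameters t and s of the pencils of x and y, in terms of which
   dlog (x + a) = t / (t + phi a) dlog x and similarly for y. *)
Lemma pair_parameters : exists (phi : {rmorphism k -> l}) (t s : L),
  [/\ t != 0, s != 0,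
   (forall D, D (T x) = 0 -> D t = 0), (forall D, D (T y) = 0 -> D s = 0) &
   [/\ forall a, slope x D1 a * (t + iL (phi a)) = t,
       forall b, slope y D2 b * (s + iL (phi b)) = s &
       forall c d, c != 0 ->
         let w := t + iL (phi c) * s + iL (phi d) in
         dlog (combo c d) D1 * w = t /\ dlog (combo c d) D2 * w = iL (phi c) * s]].
Proof.
have [phi [AE BE]] := pair_embedding.
have e0 : A 1 - 1 != 0 by exact: slope1_inv_neq1.
have f0 : B 1 - 1 != 0 by exact: slope1_inv_neq1.
(* With t = 1 / (A 1 - 1) the affine formula for A reads A a = (t + phi a) / t, and similarly for s
   and B. *)
exists phi, (A 1 - 1)^-1, (B 1 - 1)^-1; split; rewrite ?invr_eq0//.
- move=> D Dx; apply: der_inv_eq0 => //; rewrite derB der1 subr0.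
  by apply: der_inv_eq0; [exact: slope_neq0|exact: slope_dep].
- move=> D Dy; apply: der_inv_eq0 => //; rewrite derB der1 subr0.
  by apply: der_inv_eq0; [exact: slope_neq0|exact: slope_dep].
split.
- move=> a; have := AE a; rewrite /A => e; have := slope_neq0 nx x1 a => s0.
  apply: (mulfI e0); rewrite mulrCA mulrDr divff// -/(A 1) -e mulfV//.
- move=> b; have := BE b; rewrite /B => e; have := slope_neq0 ny y2 b => s0.
  apply: (mulfI f0); rewrite mulrCA mulrDr divff// -/(B 1) -e mulfV//.
move=> c d c0 w; have [_ h _] := comboP d c0.
set u := dlog _ D1 in h *; set v := dlog _ D2 in h *.
(* Two points of the line, at b = 0 and b = 1, determine both coefficients u and v. *)
have h0 := h d 0 (etrans (congr1 _ (mulr0 c)) (addr0 d)).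
have h1 := h (d - c) 1 (etrans (congr1 _ (mulr1 c)) (subrK c d)).
rewrite AE [B 0]BE !rmorph0 mulr0 addr0 mulr1 in h0.
rewrite AE [B 1]BE !rmorphB !rmorph1 mulr1 in h1.
have e1 : u * (A 1 - 1) * iL (phi c) = v * (B 1 - 1).
  apply: subr0_eq; rewrite -[RHS](subrr (1 : L)) -[X in _ = X - _]h0.
  by rewrite -[X in _ = _ - X]h1; ring.
have uw : u * w = (A 1 - 1)^-1.
  apply: (mulfI e0); rewrite mulfV// -[RHS]h0 /w.
  have -> : v = u * (A 1 - 1) * iL (phi c) / (B 1 - 1) by rewrite e1 mulfK.
  by field; rewrite e0 f0.
split=> //; have -> : v = u * (A 1 - 1) * iL (phi c) / (B 1 - 1) by rewrite e1 mulfK.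
transitivity ((A 1 - 1) * iL (phi c) / (B 1 - 1) * (u * w)); first by ring.
by rewrite uw; field; rewrite e0 f0.
Qed.

(** The equation says dlog (f + a) = n dt / (t + phi a), so [T (f + iK a)] is the n-th power of t +
    phi a up to a constant. *)
Definition parametrizes (phi : k -> l) (n : int) (f : K) (t : L) :=
  ~ range iL t /\
  forall a D, n%:~R * D t = (t + iL (phi a)) * dlog (f + iK a) D.

Section PencilForms.
Variables (phi : {rmorphism k -> l}) (t s : L).
Hypotheses (t0 : t != 0) (s0 : s != 0).
Hypotheses (t_dep : forall D, D (T x) = 0 -> D t = 0).
Hypotheses (s_dep : forall D, D (T y) = 0 -> D s = 0).
Hypothesis slope_t : forall a, slope x D1 a * (t + iL (phi a)) = t.
Hypothesis slope_s : forall b, slope y D2 b * (s + iL (phi b)) = s.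
Hypothesis combo_ts : forall c d, c != 0 ->
  let w := t + iL (phi c) * s + iL (phi d) in
  dlog (combo c d) D1 * w = t /\ dlog (combo c d) D2 * w = iL (phi c) * s.

(* dlog (x + y) = (t dlog x + s dlog y) / (t + s) is a closed form. *)
Lemma pair_closed : exists2 kap, range iL kap &
  (forall D, D t = kap * t * dlog x D) /\ (forall D, D s = kap * s * dlog y D).
Proof.
have X2 : D2 (T x) = 0 by rewrite derT x2 mul0r.
have Y1 : D1 (T y) = 0 by rewrite derT y1 mul0r.
have X1 : D1 (T x) = T x by rewrite derT x1 mul1r.
have Y2 : D2 (T y) = T y by rewrite derT y2 mul1r.
have [p0 _ pE] := comboP 0 (oner_neq0 k).
have := combo_ts 0 (oner_neq0 k); rewrite /= rmorph0 !rmorph1 rmorph0 mul1r addr0.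
set p := combo 1 0 in pE *; set w := t + s; move=> [w1 w2].
have w0 : w != 0 by apply: contraTneq t0 => w0; rewrite -w1 w0 mulr0 eqxx.
(* The bracket kills [T x] and [T y], hence also dlog p; expanding this value yields t D2 s = s D1
   t. *)
have : dlog p (der_bracket D1 D2) = 0.
  by rewrite pE /dlog /= X1 X2 Y2 Y1 !der0 !subrr !mul0r !mulr0 addr0.
have -> : dlog p (der_bracket D1 D2) = D1 (dlog p D2) - D2 (dlog p D1).
  by rewrite /dlog /= !der_div//; field.
have -> : dlog p D1 = t / w by rewrite -w1 mulfK.
have -> : dlog p D2 = s / w by rewrite -w2 mulfK.
rewrite !der_div// !derD (s_dep Y1) (t_dep X2) addr0 add0r !mul0r !sub0r.
move=> e; have {}e : t * D2 s = s * D1 t.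
  apply: subr0_eq; move: e; rewrite -mulrBl => /eqP.
  rewrite mulf_eq0 invr_eq0 expf_eq0 (negPf w0) andbF orbF => /eqP <-; ring.
have ks : D1 t / t = D2 s / s.
  by apply/eqP; rewrite eqr_div// mulrC -e mulrC.
(* The common value of D1 t / t and D2 s / s depends on x only and on y only, so it is a
   constant. *)
exists (D1 t / t).
  apply: dep_const => D Dz.
    by rewrite der_div// (t_dep Dz) (der_dep x1 t_dep Dz) mul0r mulr0 subrr mul0r.
  by rewrite ks der_div// (s_dep Dz) (der_dep y2 s_dep Dz) mul0r mulr0 subrr mul0r.
split=> D; first by rewrite divfK// (der_decomp x1 t_dep) mulrC.
by rewrite ks divfK// (der_decomp y2 s_dep) mulrC.
Qed.

Lemma shift_neq0 a : t + iL (phi a) != 0.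
Proof. by apply: contraTneq t0 => e; rewrite -(slope_t a) e mulr0 eqxx. Qed.

(* Otherwise all phi a would be rational, including phi (sqrt (-1)). *)
Lemma kappa_neq0 kap : (forall D, D t = kap * t * dlog x D) ->
  kap != 0.
Proof.
move=> Dt; apply/eqP => kap0.
have tconst D : D t = 0 by rewrite Dt kap0 !mul0r.
have X1 : D1 (T x) = T x by rewrite derT x1 mul1r.
(* As t is constant, [T (x + iK a)] is an eigenvector of [D1] with the constant eigenvalue t / (t +
   phi a), which is therefore rational. *)
have rat a : exists m n : int, n != 0 /\ n%:~R * t = m%:~R * (t + iL (phi a)).
  have slopeE : slope x D1 a = t / (t + iL (phi a)).
    by rewrite -[X in X / _](slope_t a) mulfK// shift_neq0.
  have [||m [n [n0 e]]] := @eigenvalue_rational l L iL char_l D1 (T x)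
      (T (x + iK a)) (slope x D1 a) (T_neq0 x) (T_neq0 _) X1 (derT _ _).
  - by rewrite slopeE der_div ?shift_neq0// derD derC !tconst; ring.
  - by move=> D' Dx; rewrite derT (dlog_shift nx x1) /dlog Dx; ring.
  by exists m, n; split=> //; rewrite -e -mulrA slope_t.
have [j j2] : exists j : k, j ^+ 2 = -1.
  have [j] := @GRing.solve_monicpoly k 2 (fun m => if m is 0 then -1 else 0) isT.
  by rewrite !big_ord_recr big_ord0 /= add0r mul0r addr0 expr0 mulr1 => e; exists j.
have [m1 [n1 [n10 e1]]] := rat 1; have [m2 [n2 [n20 e2]]] := rat j.
rewrite rmorph1 rmorph1 in e1.
have mneq (m n : int) a : n != 0 -> n%:~R * t = m%:~R * (t + iL (phi a)) -> m != 0.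
  move=> n0 e; apply: contraTneq n0 => m0; move: e; rewrite m0 mul0r => /eqP.
  rewrite mulf_eq0 (negPf t0) orbF => e; apply/negPn; apply: contraTT e.
  exact: intr_neq0 (pchar0_ext iL char_l) _.
have m10 : m1 != 0 by apply: (mneq m1 n1 1 n10); rewrite !rmorph1.
have m20 := mneq _ _ _ n20 e2.
(* Taking a = 1 makes t rational, then a = j makes phi j = p / q rational; its square is -1, whereas
   p^2 + q^2 is nonzero. *)
pose q := ((n1 - m1) * m2) : int; pose p := (m1 * (n2 - m2)) : int.
have e1' : (n1 - m1)%:~R * t = m1%:~R by rewrite rmorphB /= mulrBl e1; ring.
have e2' : (n2 - m2)%:~R * t = m2%:~R * iL (phi j) by rewrite rmorphB /= mulrBl e2; ring.
have pq : p%:~R = q%:~R * iL (phi j).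
  by rewrite /p /q !rmorphM /= -e1' -[RHS]mulrA -e2'; ring.
have q0 : q != 0.
  rewrite mulf_neq0//; apply/eqP => d0; move: e1'; rewrite d0 mul0r => /esym/eqP.
  by rewrite (negPf (intr_neq0 (pchar0_ext iL char_l) m10)).
have : (p ^+ 2 + q ^+ 2 != 0)%R.
  by rewrite Num.Theory.paddr_eq0 ?Num.Theory.sqr_ge0// !sqrf_eq0 (negPf q0) andbF.
move=> /(intr_neq0 (pchar0_ext iL char_l)); rewrite rmorphD !rmorphXn /= pq.
by rewrite exprMn -!rmorphXn j2 !rmorphN !rmorph1 mulrN1 addNr eqxx.
Qed.

(** Write kap = r / n in lowest terms. Then (t + j)^n is a constant times T (x + j)^r for every
    natural j, so by Bezout t + j is an r-th power up to a constant. Geometricity of L gives |r| =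
    1, and 1 / kap is the integer n r. *)
Lemma pair_exponent : exists2 n : int, n != 0 &
  (forall D, n%:~R * D t = t * dlog x D) /\ (forall D, n%:~R * D s = s * dlog y D).
Proof.
have charL := pchar0_ext iL char_l.
have [kap kap_range [Dt Ds]] := pair_closed.
have kap0 := kappa_neq0 Dt.
have t1 : D1 t = kap * t by rewrite Dt x1 mulr1.
have X1 : D1 (T x) = T x by rewrite derT x1 mul1r.
have kapD : D1 kap = 0 by have [c _ <-] := kap_range; rewrite derC.
have [m0 [n0 [n00 e]]] := eigenvalue_rational char_l (T_neq0 x) t0 X1 t1 kapD t_dep.
have [u [v bez]] := Bezoutz n0 m0.
have /dvdzP[n nE] := dvdz_gcdl n0 m0; have /dvdzP[r rE] := dvdz_gcdr n0 m0.
have g0 : gcdz n0 m0 != 0 by rewrite gcdz_eq0 (negPf n00).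
have unvr : u * n + v * r = 1.
  by apply: (mulIf g0); rewrite mul1r -[RHS]bez mulrDl -!mulrA -nE -rE.
have nr : n%:~R * kap = r%:~R.
  apply: (mulIf (intr_neq0 charL g0)); rewrite mulrAC -!rmorphM /=.
  by rewrite -nE -rE.
have nt : ~ range iL t.
  move=> [c _ tc]; move: t1; rewrite -tc derC => /esym/eqP.
  by rewrite tc mulf_eq0 (negPf kap0) (negPf t0).
have r1 : `|r|%N = 1%N.
  apply: (geometric_exponent char_l geomL nt) => j.
  have xj : t + iL j%:R != 0 by rewrite -(rmorph_nat phi) shift_neq0.
  have [c _ ce] : range iL ((t + iL j%:R) ^ n / T (x + iK j%:R) ^ r).
    apply: (der_const char_l) => D.
    rewrite der_div ?expfz_neq0// !der_exprz// derD derC addr0 -/(dlog _ D).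
    have -> : D t / (t + iL j%:R) = kap * dlog (x + iK j%:R) D.
      rewrite Dt (dlog_shift nx x1) -[in X in X / _](slope_t j%:R) [phi _]rmorph_nat.
      by field; rewrite -(rmorph_nat iL).
    by rewrite mulrA nr; ring.
  exists (c ^ u), (T (x + iK j%:R) ^ u * (t + iL j%:R) ^ v); split.
    by rewrite mulf_neq0 ?expfz_neq0.
  by apply: coprime_power unvr _ => //; rewrite ce divfK ?expfz_neq0.
have rr : r * r = 1 by case: (r) r1 => [[|[|]]|[|]].
have nrk : (n * r)%:~R * kap = 1 by rewrite rmorphM /= mulrAC nr -rmorphM /= rr.
exists (n * r); first by apply: contra_eq_neq nrk => ->; rewrite mul0r eq_sym oner_neq0.
by split=> D; rewrite ?Dt ?Ds !mulrA nrk mul1r.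
Qed.

Lemma pair_lift_parameters : exists2 n : int, n != 0 &
  [/\ parametrizes phi n x t, parametrizes phi n y s &
      parametrizes phi n (x + y) (t + s)].
Proof.
have [n n0 [nt ns]] := pair_exponent; exists n => //.
have notin z D : n%:~R * D z != 0 -> ~ range iL z.
  by move=> h [c _ cz]; move: h; rewrite -cz derC mulr0 eqxx.
split; split.
- by apply: (notin t D1); rewrite nt x1 mulr1.
- by move=> a D; rewrite nt (dlog_shift nx x1) mulrA [_ * slope _ _ _]mulrC slope_t.
- by apply: (notin s D2); rewrite ns y2 mulr1.
- by move=> b D; rewrite ns (dlog_shift ny y2) mulrA [_ * slope _ _ _]mulrC slope_s.
- apply: (notin (t + s) D1); rewrite derD mulrDr nt ns x1 y1 mulr1 mulr0 addr0.
  exact: t0.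
move=> d D; rewrite derD mulrDr nt ns.
have [_ _ pE] := comboP d (oner_neq0 k).
have /= [w1 w2] := combo_ts d (oner_neq0 k); rewrite !rmorph1 mul1r in w1 w2.
have -> : x + y + iK d = combo 1 d by rewrite /combo rmorph1 mul1r.
rewrite pE -[X in X * _ + _ = _]w1 -[X in _ + X * _ = _]w2; ring.
Qed.

End PencilForms.

Lemma dual_pair_lift : exists (phi : {rmorphism k -> l}) (n : int) (t s : L),
  n != 0 /\ [/\ parametrizes phi n x t, parametrizes phi n y s &
      parametrizes phi n (x + y) (t + s)].
Proof.
have [phi [t [s [t0 s0 td sd [st ss cts]]]]] := pair_parameters.
have [n n0 h] := pair_lift_parameters t0 s0 td sd st ss cts.
by exists phi, n, t, s.
Qed.


End Pair.

(** * Independence of logarithmic differentials, and uniqueness of parameters *)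

Definition independent f g := exists D1 D2,
  dlog f D1 * dlog g D2 - dlog f D2 * dlog g D1 != 0.

Lemma independent_sym f g : independent f g -> independent g f.
Proof.
move=> [D1 [D2 h]]; exists D2, D1; apply: contraNN h => /eqP h.
by apply/eqP; rewrite -[RHS]h; ring.
Qed.

(** The coefficients come from inverting the 2 by 2 matrix of values of the two forms. *)
Lemma independent_dual f g : independent f g -> exists D1 D2,
  [/\ dlog f D1 = 1, dlog f D2 = 0, dlog g D1 = 0 & dlog g D2 = 1].
Proof.
move=> [D1 [D2]]; set m := _ - _ => m0.
exists (der_lin (dlog g D2 / m) D1 (- (dlog g D1 / m)) D2).
exists (der_lin (- (dlog f D2 / m)) D1 (dlog f D1 / m) D2).
by rewrite !dlog_lin; split; move: m0; rewrite /m => m0; field.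
Qed.

Lemma dependentP f g D D' : ~ independent f g ->
  dlog f D * dlog g D' = dlog f D' * dlog g D.
Proof.
by move=> ng; apply: subr0_eq; apply: contrapT => /eqP h; apply: ng; exists D, D'.
Qed.

(** Here dlog g is a nonzero multiple of dlog f. *)
Lemma dependent_trans f g h : ~ range iK g ->
  ~ independent f g -> independent f h -> independent g h.
Proof.
move=> ng nfg /independent_dual[D1 [D2 [f1 f2 h1 h2]]]; exists D1, D2.
rewrite h1 h2 mulr1 mulr0 subr0; have [D] := dlog_neq0 ng.
have := dependentP D1 D nfg; rewrite f1 mul1r => ->.
by apply: contraNN => /eqP ->; rewrite mulr0.
Qed.

Lemma independent_or f g h : ~ range iK f -> independent g h ->
  independent f g \/ independent f h.
Proof.
move=> nf gh; have [|nfg] := pselect (independent f g); first by left.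
by right; apply: dependent_trans gh => // /independent_sym.
Qed.

Lemma pair_lift f g : ~ range iK f -> ~ range iK g -> independent f g ->
  exists (phi : {rmorphism k -> l}) (n : int) (t s : L),
  n != 0 /\ [/\ parametrizes phi n f t, parametrizes phi n g s &
      parametrizes phi n (f + g) (t + s)].
Proof.
move=> nf ng /independent_dual[D1 [D2 [f1 f2 g1 g2]]].
exact: dual_pair_lift f1 f2 g1 g2.
Qed.

(** Eliminating the form dlog (f + a) leaves an identity in a. Its values at a = 0 and a = 1 give N
    = N' and t = t', whence n = n' and phi = phi'. *)
Lemma parametrizes_unique (phi phi' : {rmorphism k -> l}) n n' f t t' :
  n != 0 -> n' != 0 -> parametrizes phi n f t -> parametrizes phi' n' f t' ->
  [/\ n = n', t = t' & phi =1 phi'].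
Proof.
move=> n0 n'0 [nt tE] [nt' tE']; have charL := pchar0_ext iL char_l.
have [D Dt] := der_neq0 char_l nt.
pose N : L := n%:~R * D t; pose N' : L := n'%:~R * D t'.
have N0 : N != 0 by rewrite /N Dt mulr1 intr_neq0.
have main a : N * (t' + iL (phi' a)) = N' * (t + iL (phi a)).
  by rewrite /N /N' (tE a) (tE' a); ring.
have e0 := main 0; rewrite !rmorph0 !addr0 in e0.
have ea a : N * iL (phi' a) = N' * iL (phi a).
  by have := main a; rewrite !mulrDr e0 => /addrI.
have NN' : N = N' by have := ea 1; rewrite !rmorph1 !mulr1.
have tt' : t = t' by apply: (mulfI N0); rewrite e0 NN'.
split=> // [|a]; last by apply: (fmorph_inj iL); apply: (mulfI N0); rewrite ea NN'.
apply: subr0_eq; apply: contrapT => /eqP /(intr_neq0 charL).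
rewrite rmorphB /= (_ : n%:~R = n'%:~R) ?subrr ?eqxx//.
by move: NN'; rewrite /N /N' -tt' Dt !mulr1.
Qed.

Lemma parametrizes_notin (phi : {rmorphism k -> l}) n f t :
  n != 0 -> parametrizes phi n f t -> ~ range iK f.
Proof.
move=> n0 [nt tE] [c _ cf]; have [D Dt] := der_neq0 char_l nt.
(* The shift by 1 - c turns the constant f into 1, whose dlog vanishes. *)
have := tE (1 - c) D; rewrite -cf -rmorphD [c + _]addrC subrK.
rewrite dlogC ?oner_neq0// Dt mulr1 mulr0.
by apply/eqP/intr_neq0 => //; exact: (pchar0_ext iL).
Qed.

Hypothesis T_indep : exists f1 f2, [/\ ~ range iK f1, ~ range iK f2 & independent f1 f2].

Lemma independent_exists f : ~ range iK f -> exists2 g, ~ range iK g & independent f g.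
Proof.
move=> nf; have [f1 [f2 [n1 n2 /(independent_or nf)[|] h]]] := T_indep; first by exists f1.
by exists f2.
Qed.

(** Any non-constant f is independent of one of two fixed functions, and uniqueness of the
    parameters of that function transfers its phi and n to f. *)
Lemma global_parameters : exists (phi : {rmorphism k -> l}) (n : int), n != 0 /\
  forall f, ~ range iK f -> exists t, parametrizes phi n f t.
Proof.
have [f1 [f2 [n1 n2 g12]]] := T_indep.
have [phi [n [t1 [t2 [n0 [p1 p2 _]]]]]] := pair_lift n1 n2 g12.
exists phi, n; split=> // f nf.
have [g [t pg] [ng fg]] : exists2 g, exists t, parametrizes phi n g t &
    ~ range iK g /\ independent f g.
  have [h|h] := independent_or nf g12; first by exists f1 => //; exists t1.
  by exists f2 => //; exists t2.
have [phi' [n' [u [v [n'0 [[nu pu] pv _]]]]]] := pair_lift nf ng fg.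
have [nn' _ phiE] := parametrizes_unique n0 n'0 pg pv.
by exists u; split=> // a D; rewrite nn' phiE.
Qed.

(** * The parameter map psi is additive and multiplicative *)

Section Global.
Variables (phi : {rmorphism k -> l}) (n : int) (psi : K -> L).
Hypothesis n0 : n != 0.
Hypothesis psiC : forall c, psi (iK c) = iL (phi c).
Hypothesis psiP : forall f, ~ range iK f -> parametrizes phi n f (psi f).

Lemma psi_unique f t : parametrizes phi n f t -> psi f = t.
Proof.
move=> pf; have /psiP pf' := parametrizes_notin n0 pf.
by have [] := parametrizes_unique n0 n0 pf' pf.
Qed.

Lemma psi_neq0 f : f != 0 -> psi f != 0.
Proof.
have [[c _ <-]|/psiP[nf _] _] := pselect (range iK f).
  by rewrite psiC !fmorph_eq0.
by apply: contra_notN nf => /eqP ->; exists 0; rewrite ?rmorph0.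
Qed.

Lemma psi_shift f c : ~ range iK f -> psi (f + iK c) = psi f + iL (phi c).
Proof.
move=> /psiP[nf pf]; apply: psi_unique; split=> [|a D].
  by apply: contra_not nf => -[e _ ee]; exists (e - phi c); rewrite // rmorphB ee addrK.
by rewrite derD derC addr0 (pf (c + a)) !rmorphD !addrA.
Qed.

Lemma psi_scale f c : ~ range iK f -> c != 0 -> psi (iK c * f) = iL (phi c) * psi f.
Proof.
move=> nf c0; have [nt pf] := psiP nf; apply: psi_unique; split=> [|a D].
  apply: contra_not nt => -[e _ ee]; exists (e / phi c); rewrite // fmorph_div ee.
  by rewrite mulrC mulKf// !fmorph_eq0.
rewrite derCM mulrCA (pf (a / c)) mulrA mulrDr -rmorphM -(rmorphM phi).
have -> : iK c * f + iK a = iK c * (f + iK (a / c)).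
  by rewrite mulrDr -rmorphM; congr (_ + iK _); field.
rewrite dlogCM ?notin_neq0//; last exact: notin_shift.
by congr ((_ + iL (phi _)) * _); field.
Qed.

Lemma psiN f : ~ range iK f -> psi (- f) = - psi f.
Proof.
move=> nf; have N1 : (-1 : k) != 0 by rewrite oppr_eq0 oner_neq0.
by have := psi_scale nf N1; rewrite !rmorphN !rmorph1 !mulN1r.
Qed.

Lemma psi_independentD f g : ~ range iK f -> ~ range iK g -> independent f g ->
  ~ range iK (f + g) /\ psi (f + g) = psi f + psi g.
Proof.
move=> nf ng fg; have [phi' [n' [t [s [n'0 [pf pg [nts pfg]]]]]]] := pair_lift nf ng fg.
have [nn' <- phiE] := parametrizes_unique n'0 n0 pf (psiP nf).
have [_ <- _] := parametrizes_unique n'0 n0 pg (psiP ng).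
have pfg' : parametrizes phi n (f + g) (t + s).
  by split=> // a D; rewrite -nn' -phiE.
by split; [exact: parametrizes_notin pfg'|exact: psi_unique].
Qed.

Lemma psi_dlog f D : ~ range iK f -> n%:~R * D (psi f) = psi f * dlog f D.
Proof. by move=> /psiP[_ /(_ 0 D)]; rewrite !rmorph0 !addr0. Qed.

(** Otherwise [D2], dual to h and killing dlog f and dlog g, would kill psi (g + h) = psi g + psi h,
    whereas n D2 of this sum is psi h. *)
Lemma independentDr f g h : ~ range iK f -> ~ range iK g -> ~ range iK h ->
  ~ independent f g -> independent f h -> independent f (g + h).
Proof.
move=> nf ng nh nfg fh; have gh := dependent_trans ng nfg fh.
have [ngh ghE] := psi_independentD ng nh gh.
have [D1 [D2 [f1 f2 h1 h2]]] := independent_dual fh.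
have g2 : dlog g D2 = 0 by have := dependentP D1 D2 nfg; rewrite f1 f2 mul1r mul0r.
exists D1, D2; rewrite f1 f2 mul1r mul0r subr0.
apply: contraTN (psi_neq0 (notin_neq0 nh)) => /eqP e; apply/negPn.
have := psi_dlog D2 ngh; rewrite ghE e mulr0 derD mulrDr !psi_dlog// g2 h2.
by rewrite mulr0 mulr1 add0r => ->.
Qed.

Lemma psiD : {morph psi : f g / f + g}.
Proof.
move=> f g; have [[c _ <-]|nf] := pselect (range iK f).
  have [[d _ <-]|ng] := pselect (range iK g); first by rewrite -rmorphD !psiC !rmorphD.
  by rewrite addrC psi_shift// psiC addrC.
have [[d _ <-]|ng] := pselect (range iK g); first by rewrite psi_shift// psiC.
have [/(psi_independentD nf ng)[]//|nfg] := pselect (independent f g).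
have [[c _ cE]|nz] := pselect (range iK (f + g)).
  have nNf : ~ range iK (- f).
    by apply: contra_not nf => -[e _ ee]; exists (- e); rewrite // rmorphN ee opprK.
  have -> : g = - f + iK c by rewrite cE addKr.
  by rewrite psi_shift// psiN// [f + _]addrA subrr add0r psiC [_ + (_ + _)]addrA subrr add0r.
(* In this case additivity is applied to the pair f + g and -f, whose sum is g. *)
have [zf|nzf] := pselect (independent (f + g) f).
  have nNf : ~ range iK (- f).
    by apply: contra_not nf => -[e _ ee]; exists (- e); rewrite // rmorphN ee opprK.
  have zNf : independent (f + g) (- f).
    move: zf => [D1 [D2 h]]; exists D1, D2.
    have dN D : dlog (- f) D = dlog f D.
      by rewrite -mulN1r -(rmorph1 iK) -rmorphN dlogCM ?oppr_eq0 ?oner_neq0// notin_neq0.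
    by rewrite !dN.
  have [_] := psi_independentD nz nNf zNf; rewrite addrAC subrr add0r psiN// => ->.
  by rewrite [RHS]addrC subrK.
(* With f, g and f + g mutually dependent, an h independent of f is added, and psi (f + g + h) is
   computed in two ways. *)
have [h nh fh] := independent_exists nf.
have gh := dependent_trans ng nfg fh.
have zh : independent (f + g) h by apply: dependent_trans fh => // /independent_sym.
have fgh := independentDr nf ng nh nfg fh.
have [ngh ghE] := psi_independentD ng nh gh.
have [_ zhE] := psi_independentD nz nh zh.
have [_ fghE] := psi_independentD nf ngh fgh.
by apply: (addIr (psi h)); rewrite -zhE -[RHS]addrA -ghE -fghE addrA.
Qed.

(** The quotient of the two sides is killed by every derivation. *)
Lemma psi_power f : f != 0 -> exists2 c, c != 0 & T f = iL c * psi f ^ n.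
Proof.
move=> f0; have psi0 := psi_neq0 f0.
have [c _ ce] : range iL (T f / psi f ^ n).
  apply: (der_const char_l) => D.
  have [[c _ cf]|nf] := pselect (range iK f).
    have [c' _ c'E] : range iL (T f) by apply/T_const => //; exists c.
    by rewrite -c'E -cf psiC -fmorphXz -fmorph_div derC.
  have e : n%:~R * (D (psi f) / psi f) = dlog f D.
    by rewrite mulrA psi_dlog// mulrC mulKf.
  by rewrite der_div ?expfz_neq0// der_exprz// derT e; ring.
by exists c; rewrite -?(fmorph_eq0 iL) ce ?divfK ?mulf_neq0 ?invr_eq0 ?expfz_neq0.
Qed.

Hypothesis T_prim : exists2 f : K, f != 0 & primitive (uclass iL (T f)).

Lemma exponent_unit : `|n|%N = 1%N.
Proof.
have [f f0 prim] := T_prim; have [c c0 e] := psi_power f0.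
have := uclass_power_nonprimitive (T_neq0 f) (psi_neq0 f0) e.
by case: n n0 => [[|[|m]]|[|m]]//= _ /(_ isT).
Qed.

Lemma psi_lift f : f != 0 -> exists2 c, c != 0 & psi f = iL c * T f ^ n.
Proof.
move=> f0; have [c c0 e] := psi_power f0; exists (c ^ n)^-1.
  by rewrite invr_eq0 expfz_neq0.
have nn : n * n = 1 by case: (n) exponent_unit => [[|[|]]|[|]].
by rewrite e expfzMl exprz_exp nn expr1z fmorphV fmorphXz mulKf// expfz_neq0 ?fmorph_eq0.
Qed.

Lemma psiM_class f g : f != 0 -> g != 0 ->
  exists c, psi (f * g) = iL c * (psi f * psi g).
Proof.
move=> f0 g0; have [c _ ->] := psi_lift (mulf_neq0 f0 g0).
have [c1 c10 ->] := psi_lift f0; have [c2 c20 ->] := psi_lift g0.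
have [c3 ->] := T_mul f0 g0; exists (c * c3 ^ n / (c1 * c2)).
rewrite !expfzMl fmorph_div !rmorphM fmorphXz; field.
by rewrite !fmorph_eq0 c10 c20.
Qed.

(** Multiplicativity holds up to constants c for (f, g) and c' for (f, g + 1). Additivity gives (c -
    c') psi g = c' - 1, and as psi g is not constant, c = c' = 1. *)
Lemma psiM : {morph psi : f g / f * g}.
Proof.
have psi0 : psi 0 = 0 by rewrite -(rmorph0 iK) psiC !rmorph0.
have scale c f : psi (iK c * f) = iL (phi c) * psi f.
  have [->|c0] := eqVneq c 0; first by rewrite !rmorph0 !mul0r.
  have [[d _ <-]|nf] := pselect (range iK f); last exact: psi_scale.
  by rewrite -rmorphM !psiC !rmorphM.
move=> f g; have [[c _ <-]|nf] := pselect (range iK f); first by rewrite scale psiC.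
have [[c _ <-]|ng] := pselect (range iK g); first by rewrite mulrC scale psiC mulrC.
have f0 := notin_neq0 nf; have g0 := notin_neq0 ng.
have g10 := notin_neq0 (notin_shift 1 ng).
have [c e] := psiM_class f0 g0; have [c' e'] := psiM_class f0 g10.
move: e'; rewrite (psi_shift 1 ng) rmorph1 mulrDr mulr1 psiD e !rmorph1.
move=> e'; have {}e' : iL (c - c') * psi g = iL (c' - 1).
  apply: (mulfI (psi_neq0 f0)); apply: subr0_eq; move/eqP: e'; rewrite -subr_eq0 => /eqP <-.
  by rewrite !rmorphB rmorph1; ring.
have [cc'|cc'] := eqVneq c c'.
  move: e'; rewrite cc' subrr rmorph0 mul0r => /esym/eqP; rewrite fmorph_eq0 subr_eq0.
  by move=> /eqP ->; rewrite rmorph1 mul1r.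
have [nt _] := psiP ng; case: nt; exists ((c' - 1) / (c - c')) => //.
by rewrite fmorph_div -e' mulrC mulKf// fmorph_eq0 subr_eq0.
Qed.

End Global.

Lemma lift_embedding :
  (exists2 f : K, f != 0 & primitive (uclass iL (T f))) ->
  exists psi : {rmorphism K -> L},
    (forall f, f != 0 -> exists2 c, c != 0 & psi f = iL c * T f) \/
    (forall f, f != 0 -> exists2 c, c != 0 & psi f = iL c * (T f)^-1).
Proof.
move=> prim; have [phi [n [n0 nP]]] := global_parameters.
have /choice[psi psiE] f : exists v, (forall c, f = iK c -> v = iL (phi c)) /\
    (~ range iK f -> parametrizes phi n f v).
  have [[c _ cf]|nf] := pselect (range iK f).
    exists (iL (phi c)); split=> [d|[]]; last by exists c.
    by rewrite -cf => /fmorph_inj ->.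
  have [t pt] := nP f nf; exists t; split=> // c fc.
  by case: nf; exists c.
have psiC c : psi (iK c) = iL (phi c) by have [h _] := psiE (iK c); exact: h.
have psiP f : ~ range iK f -> parametrizes phi n f (psi f) by have [_] := psiE f.
have psi_zmod : zmod_morphism psi.
  move=> f g; have := psiD n0 psiC psiP (f - g) g.
  by rewrite subrK => ->; rewrite addrK.
have psi_monoid : monoid_morphism psi.
  split; last exact: psiM n0 psiC psiP prim.
  by rewrite -(rmorph1 iK) psiC !rmorph1.
pose psiZ := GRing.isZmodMorphism.Build K L psi psi_zmod.
pose psiMM := GRing.isMonoidMorphism.Build K L psi psi_monoid.
pose psiR : {rmorphism K -> L} := HB.pack psi psiZ psiMM.
have lift f := @psi_lift phi n psi n0 psiC psiP prim f.
exists psiR; case: (n) (exponent_unit n0 psiC psiP prim) lift => [[|[|]]|[|]]// _ h.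
  by left.
by right.
Qed.

End LogarithmicDifferentials.

(** * Representatives of unit classes *)

Section UnitLift.
Variables (l L : fieldType) (i : {rmorphism l -> L}).

Definition uq_lift (u : unit_quot i) : L := val (repr u).

Lemma uq_lift_neq0 u : uq_lift u != 0.
Proof. exact: nz_neq0 (repr u). Qed.

Lemma uq_liftK u : uclass i (uq_lift u) = u.
Proof. by rewrite /uclass /uq_lift valKd reprK. Qed.

Lemma uclass_eq1 f : f != 0 -> (uclass i f = 1)%g <-> range i f.
Proof.
move=> f0; have <- : uclass i 1 = 1%g by rewrite -(expr0 (1 : L)) uclassX ?oner_neq0.
rewrite uclass_eq ?oner_neq0//; split=> [[c [_ ->]]|[c _ cf]].
  by exists c; rewrite // mulr1.
by exists c; rewrite mulr1 cf -(fmorph_eq0 i) cf.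
Qed.

Lemma simple_ext_horner (x : L) p : simple_ext i x (map_poly i p).[x].
Proof. by exists p, 1; rewrite rmorph1 hornerE divr1 oner_neq0. Qed.

Lemma alg_closure_in_shift (x : L) c : alg_closure_in (simple_ext i x) (x + i c).
Proof.
exists ('X - (x + i c)%:P); split; first by rewrite polyXsubC_eq0.
  have := @simple_ext_horner x; move=> h [|[|j]]; rewrite coefB coefX coefC /=.
  - have := h (- 'X - c%:P).
    by rewrite rmorphB rmorphN /= map_polyX map_polyC !hornerE opprD.
  - by have := h 1; rewrite rmorph1 hornerE subr0.
  - by have := h 0; rewrite rmorph0 hornerE subr0.
by rewrite root_XsubC.
Qed.

End UnitLift.

Theorem theorem2
  (k l : closedFieldType) (K L : fieldType)
  (iK : {rmorphism k -> K}) (iL : {rmorphism l -> L})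
  (char_k : [pchar k] =i pred0) (char_l : [pchar l] =i pred0)
  (geomK : geometric iK) (trdegK : trdeg_ge2 iK)
  (geomL : geometric iL) (trdegL : trdeg_ge2 iL)
  (psi1 : {multiplicative unit_quot iK -> unit_quot iL})
  (psi1_inj : injective psi1)
  (psi1_prim : exists u : unit_quot iL, range psi1 u /\ primitive u)
  (psi1_indep : exists g1 g2 : L,
     [/\ g1 != 0, g2 != 0, range psi1 (uclass iL g1),
         range psi1 (uclass iL g2) & alg_indep iL g1 g2])
  (psi1_closure : forall f : K, f != 0 -> ~ range iK f ->
     exists g : L, psi1 @` closure_classes iK f `<=` closure_classes iL g) :
  exists psi : {rmorphism K -> L},
    (forall f : K, f != 0 -> uclass iL (psi f) = psi1 (uclass iK f)) \/
    (forall f : K, f != 0 -> uclass iL (psi f) = ((psi1 (uclass iK f))^-1)%g).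
Proof.
have psi11 : psi1 1%g = 1%g.
  by apply: (mulgI (psi1 1%g)); rewrite mulg1 -gmulfM mulg1.
pose T f := uq_lift (psi1 (uclass iK f)).
have TK f : uclass iL (T f) = psi1 (uclass iK f) by exact: uq_liftK.
have T0 f : T f != 0 by exact: uq_lift_neq0.
have T_mul f g : f != 0 -> g != 0 -> exists c, T (f * g) = iL c * (T f * T g).
  move=> f0 g0; have : uclass iL (T (f * g)) = uclass iL (T f * T g).
    by rewrite uclassM// !TK uclassM// gmulfM.
  by move=> /(uclass_eq _ (T0 _) (mulf_neq0 (T0 _) (T0 _)))[c [_ e]]; exists c.
have T_const f : f != 0 -> range iL (T f) <-> range iK f.
  move=> f0; rewrite -(uclass_eq1 iK f0) -(uclass_eq1 iL (T0 f)) TK.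
  by rewrite -[X in _ = X <-> _]psi11; split=> [/psi1_inj|->].
(* Condition (2) makes the lifts of all f + c algebraic over one l(g), so their differentials are
   multiples of the differential of g, and rho is the ratio of two such multiples. *)
have T_shift f : ~ range iK f -> forall c, exists rho, forall D : derivation iL,
    D (T (f + iK c)) / T (f + iK c) = rho * (D (T f) / T f).
  move=> nf; have f0 : f != 0 by exact: notin_neq0 nf.
  have [g gP] := psi1_closure f f0 nf.
  have Dg c (D : derivation iL) : D g = 0 -> D (T (f + iK c)) = 0.
    move=> Dg0; have fc0 : f + iK c != 0 by exact: notin_neq0 (@notin_shift _ _ iK f c nf).
    have [|w [wg w0] we] := gP (psi1 (uclass iK (f + iK c))).
      exists (uclass iK (f + iK c)) => //; exists (f + iK c) => //; split=> //.
      exact: alg_closure_in_shift.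
    move: we; rewrite -TK => /(uclass_eq _ w0 (T0 _))[e [e0 we]].
    have := der_alg_closure_in char_l Dg0 wg; rewrite we derCM => /eqP.
    by rewrite mulf_eq0 fmorph_eq0 (negPf e0) => /eqP.
  have nTf : ~ range iL (T f) by move=> /T_const -/(_ f0).
  have [D0 D0f] := der_neq0 char_l nTf.
  have Df (D : derivation iL) : D g = 0 -> D (T f) = 0 by move=> /(Dg 0); rewrite rmorph0 addr0.
  have D0g : D0 g != 0.
    by apply/eqP => /Df; rewrite D0f => /eqP; rewrite oner_eq0.
  have decomp z : (forall D : derivation iL, D g = 0 -> D z = 0) ->
      forall D : derivation iL, D z = D g / D0 g * D0 z.
    move=> zg D; have /= := zg (der_lin 1 D (- (D g / D0 g)) D0).
    rewrite !mul1r mulNr divfK// subrr => /(_ erefl)/eqP.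
    by rewrite mulNr subr_eq0 => /eqP.
  move=> c; exists (D0 (T (f + iK c)) / T (f + iK c) * T f) => D.
  rewrite (decomp _ (Dg c) D) (decomp _ Df D) D0f; field.
  by rewrite D0g !T0.
have T_indep : exists f1 f2, [/\ ~ range iK f1, ~ range iK f2 & independent iL T f1 f2].
  have [g1 [g2 [g10 g20 [u1 _ e1] [u2 _ e2] ind]]] := psi1_indep.
  (* [D1] kills g2, so the determinant testing independence is triangular, with value 1 / (g1
     g2). *)
  have [D1 [D12 D11]] := alg_indep_der char_l ind.
  have ng2 := alg_indep_range ind.
  have [D2 D22] := der_neq0 char_l ng2.
  have ng1 : ~ range iL g1.
    by move=> [c _ ce]; move: D11; rewrite -ce derC => /esym/eqP; rewrite oner_eq0.
  have lift u g : g != 0 -> psi1 u = uclass iL g -> ~ range iL g ->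
      ~ range iK (uq_lift u) /\ forall D : derivation iL, dlog T (uq_lift u) D = D g / g.
    move=> g0 e ng; split.
      rewrite -uclass_eq1 ?uq_lift_neq0// uq_liftK => u1'.
      by apply: ng; rewrite -uclass_eq1// -e u1' psi11.
    move=> D; have : uclass iL (T (uq_lift u)) = uclass iL g by rewrite TK uq_liftK.
    move=> /(uclass_eq _ (T0 _) g0)[c [c0 ce]].
    by rewrite /dlog ce derCM; field; rewrite g0 fmorph_eq0 c0.
  have [n1 d1] := lift _ _ g10 e1 ng1; have [n2 d2] := lift _ _ g20 e2 ng2.
  exists (uq_lift u1), (uq_lift u2); split=> //; exists D1, D2.
  by rewrite !d1 !d2 D11 D12 D22 mul0r mulr0 subr0 mulf_neq0// div1r invr_eq0.
have T_prim : exists2 f, f != 0 & primitive (uclass iL (T f)).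
  have [u [[v _ <-] prim]] := psi1_prim; exists (uq_lift v); first exact: uq_lift_neq0.
  by rewrite TK uq_liftK.
have [psi [psiE|psiE]] :=
  lift_embedding char_k char_l T0 T_mul T_const T_shift geomL T_indep T_prim.
  exists psi; left=> f f0; have [c c0 ->] := psiE f f0.
  by rewrite uclassCM// TK.
exists psi; right=> f f0; have [c c0 ->] := psiE f f0.
by rewrite uclassCM ?invr_eq0// uclassV// TK.
Qed.
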